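(* Let $G$ be a finite group and $(X,\theta)$ a finite-dimensional separable metric $G$-space such that $\theta$ is nice and $G*X$ is closed in $G\times X$. If $X[H]$ is an ANE for each subgroup $H$ of $G$, then $X_G$ (with the enveloping action) is a $G$-ANE.
   Context: Partial actions. A partial action of a group $G$ (identity $e$) on a set $X$ is a map $\theta:G*X\to X$, $(g,x)\mapsto g\cdot x$, defined on a subset $G*X\subseteq G\times X$ (write $\exists\, g\cdot x$ for $(g,x)\in G*X$), such that for all $g,h\in G$, $x\in X$: (PA1) if $\exists\, g\cdot x$ then $\exists\, g^{-1}\cdot(g\cdot x)$ and $g^{-1}\cdot(g\cdot x)=x$; (PA2) if $\exists\, g\cdot(h\cdot x)$ then $\exists\,(gh)\cdot x$ and $g\cdot(h\cdot x)=(gh)\cdot x$; (PA3) $\exists\, e\cdot x$ and $e\cdot x=x$. Put $X_g=\{x\in X:\exists\, g^{-1}\cdot x\}$, $\theta_g:X_{g^{-1}}\to X_g$, $x\mapsto g\cdot x$, and $G^x=\{g\in G:(g,x)\in G*X\}$. If $G$ is a topological group and $X$ a topological space, $\theta$ is topological if every $X_g$ is open in $X$ and every $\theta_g$ is a homeomorphism; continuous if $\theta$ is continuous for the subspace topology on $G*X\subseteq G\times X$; nice if it is continuous and $G*X$ is open in $G\times X$. All topological groups are Hausdorff (so a finite group is discrete) and all partial actions are topological. A $G$-space is a pair $(X,\theta)$ with $\theta$ a continuous (topological) partial action of $G$ on the topological space $X$. The isotropy group of $x$ is $G_x=\{g\in G^x:\theta(g,x)=x\}$, and for a subgroup $H\le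 G$, $X[H]=\{x\in X:H\subseteq G_x\}$ with the subspace topology. Enveloping space. $X_G=(G\times X)/R$ with the quotient topology, where $(g,x)R(h,y)$ iff $x\in X_{g^{-1}h}$ and $\theta_{h^{-1}g}(x)=y$; the class of $(g,x)$ is $[g,x]$. The enveloping action of $G$ on $X_G$ is the continuous global action $\mu(g,[h,x])=[gh,x]$. ANE's. A metrizable space $Z$ with a continuous global action of $G$ is a $G$-ANE (equivariant absolute neighborhood extensor) if for every metrizable space $Y$ with a continuous global $G$-action and every closed $G$-invariant subset $A\subseteq Y$, every continuous $G$-equivariant map $f:A\to Z$ extends to a continuous $G$-equivariant map $F:U\to Z$ for some invariant neighborhood $U$ of $A$ in $Y$. An ANE is a metrizable space satisfying this for the trivial group (the empty space is an ANE). Dimension is the covering dimension. *)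

(* Defs.v *)
From HB Require Import structures.
From mathcomp Require Import all_boot all_order all_algebra all_fingroup.
From mathcomp Require Import all_classical all_reals all_analysis.

Set Implicit Arguments.
Unset Strict Implicit.
Unset Printing Implicit Defensive.

Local Open Scope classical_set_scope.
Local Open Scope quotient_scope.

Definition metrizable (R : realType) (T : topologicalType) : Prop :=
  exists d : T -> T -> R,
    [/\ forall x y, d x y = 0%R <-> x = y,
        forall x y, d x y = d y x,
        forall x y z, (d x z <= d x y + d y z)%R &
        forall (x : T) (A : set T),
          nbhs x A <-> exists2 e : R, (0 < e)%R & [set y | (d x y < e)%R] `<=` A].

Definition separable (T : topologicalType) : Prop :=
  exists2 S : set T, countable S & dense S.

(* Čech-Lebesgue dimension: every finite open cover has a finite open
   refinement in which no point lies in more than n.+1 members. *)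
Definition covering_dim_le (T : topologicalType) (n : nat) : Prop :=
  forall (k : nat) (U : 'I_k -> set T),
    (forall i, open (U i)) -> (forall x, exists i, U i x) ->
    exists (m : nat) (V : 'I_m -> set T),
      [/\ forall j, open (V j),
          forall x, exists j, V j x,
          forall j, exists i, V j `<=` U i &
          forall (x : T) (J : {set 'I_m}),
            (forall j, j \in J -> V j x) -> (#|J| <= n.+1)%N].

Definition finite_dimensional (T : topologicalType) : Prop :=
  exists n, covering_dim_le T n.

Definition homeomorphism (S T : topologicalType) (A : set S) (B : set T)
    (f : S -> T) : Prop :=
  exists f' : T -> S,
    [/\ forall x, A x -> B (f x) /\ f' (f x) = x,
        forall y, B y -> A (f' y) /\ f (f' y) = y,
        {within A, continuous f} &
        {within B, continuous f'}].

(* A finite Hausdorff topological group is discrete, so the group type gT is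
   given the discrete topology whenever a topology on it is needed. *)
Notation discr_prod gT X := (discrete_topology gT * X)%type.

(* pa_dom is the set G*X; the values of pa_act outside pa_dom are irrelevant
   (every map G*X -> X extends to G x X -> X, also when X is empty). *)
Record partial_action (gT : finGroupType) (X : Type) := PartialAction {
  pa_dom : set (gT * X);
  pa_act : gT -> X -> X;
  pa_inv : forall g x, pa_dom (g, x) ->
    pa_dom (g^-1%g, pa_act g x) /\ pa_act g^-1%g (pa_act g x) = x;
  pa_mul : forall g h x, pa_dom (h, x) -> pa_dom (g, pa_act h x) ->
    pa_dom ((g * h)%g, x) /\ pa_act g (pa_act h x) = pa_act (g * h)%g x;
  pa_one : forall x, pa_dom (1%g, x) /\ pa_act 1%g x = x
}.

Section PartialActions.
Variables (gT : finGroupType) (X : topologicalType).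
Variable theta : partial_action gT X.

Definition pa_graph : set (discr_prod gT X) := pa_dom theta.

Definition pa_set (g : gT) : set X := [set x | pa_dom theta (g^-1%g, x)].

Definition topological_pa : Prop :=
  forall g, open (pa_set g) /\
    homeomorphism (pa_set g^-1%g) (pa_set g) (pa_act theta g).

Definition continuous_pa : Prop :=
  {within pa_graph, continuous (fun p : discr_prod gT X => pa_act theta p.1 p.2)}.

Definition G_space : Prop := topological_pa /\ continuous_pa.

Definition nice : Prop := continuous_pa /\ open pa_graph.

Definition isotropy (x : X) : set gT :=
  [set g | pa_dom theta (g, x) /\ pa_act theta g x = x].

Definition pa_fix (H : {group gT}) : set X :=
  [set x | forall h, h \in H -> isotropy x h].

Definition env_rel : rel (discr_prod gT X) := fun p q =>
  `[< pa_set (p.1^-1 * q.1)%g p.2 /\ pa_act theta (q.1^-1 * p.1)%g p.2 = q.2 >].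

Lemma env_refl : reflexive env_rel.
Proof.
move=> [g x]; apply/asboolP => /=.
by rewrite /pa_set /= mulVg invg1; exact: pa_one.
Qed.

Lemma env_symW p q : env_rel p q -> env_rel q p.
Proof.
case: p q => [g x] [h y] /asboolP /= []; rewrite /pa_set /= invMg invgK => D E.
have [D' E'] := pa_inv D; apply/asboolP => /=.
rewrite /pa_set /= invMg invgK -E.
by rewrite invMg invgK in D' E'.
Qed.

Lemma env_sym : symmetric env_rel.
Proof. by move=> p q; apply/idP/idP; exact: env_symW. Qed.

Lemma env_trans : transitive env_rel.
Proof.
move=> [h y] [g x] [k z] /asboolP /= []; rewrite /pa_set /= invMg invgK => D E.
move=> /asboolP /= []; rewrite /pa_set /= invMg invgK -E => D' <-.
have := pa_mul D D'; rewrite mulgA -(mulgA k^-1%g) mulgV mulg1 => -[D2 E2].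
by apply/asboolP; rewrite /pa_set /= invMg invgK E2.
Qed.

Canonical env_equiv := EquivRel env_rel env_refl env_sym env_trans.

Definition env_space : topologicalType :=
  quotient_topology {eq_quot env_equiv}.

Definition env_class (p : discr_prod gT X) : env_space :=
  \pi_(quotient_topology {eq_quot env_equiv}) p.

(* mu(g, [h, x]) = [gh, x]; independence of the representative is env_actE. *)
Definition env_act (g : gT) (z : env_space) : env_space :=
  let p : discr_prod gT X := generic_quotient.repr z in
  env_class ((g * p.1)%g, p.2).

Lemma env_classP p q : env_class p = env_class q <-> env_rel p q.
Proof. by split=> [/eqquotP//|?]; exact/eqquotP. Qed.

Lemma env_actE g h x : env_act g (env_class (h, x)) = env_class ((g * h)%g, x).
Proof.
apply/env_classP; set p := generic_quotient.repr _.
have : env_rel p (h, x) by apply/env_classP; rewrite /env_class reprK.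
by rewrite /env_rel !invMg !mulgA -!(mulgA _ g^-1%g) mulVg !mulg1.
Qed.

End PartialActions.

Section ANE.
Variables (R : realType) (gT : finGroupType).

Definition continuous_global_action (Y : topologicalType)
    (a : gT -> Y -> Y) : Prop :=
  [/\ forall y, a 1%g y = y,
      forall g h y, a g (a h y) = a (g * h)%g y &
      continuous (fun p : discr_prod gT Y => a p.1 p.2)].

Definition invariant_set (Y : Type) (a : gT -> Y -> Y) (A : set Y) : Prop :=
  forall g y, A y -> A (a g y).

Definition equivariant_on (Y Z : Type) (aY : gT -> Y -> Y) (aZ : gT -> Z -> Z)
    (A : set Y) (f : Y -> Z) : Prop :=
  forall g y, A y -> f (aY g y) = aZ g (f y).

(* A map A -> Z is represented by a function Y -> Z of which only the values
   on A matter. For Z nonempty every map on A arises in this way; for Z empty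
   the only map is the one with A empty, which extends to U empty, so that
   nothing is lost by Y -> Z having no element when Y is nonempty. *)
Definition G_ANE (Z : topologicalType) (aZ : gT -> Z -> Z) : Prop :=
  [/\ metrizable R Z, continuous_global_action aZ &
    forall (Y : topologicalType) (aY : gT -> Y -> Y),
      metrizable R Y -> continuous_global_action aY ->
      forall A : set Y, closed A -> invariant_set aY A ->
      forall f : Y -> Z,
        {within A, continuous f} -> equivariant_on aY aZ A f ->
        exists (U : set Y) (F : Y -> Z),
          [/\ A `<=` U°, invariant_set aY U,
              {within U, continuous F}, equivariant_on aY aZ U F &
              {in A, F =1 f}]].

(* G_ANE for the trivial group. *)
Definition ANE (Z : topologicalType) : Prop :=
  metrizable R Z /\
  forall Y : topologicalType, metrizable R Y ->
    forall A : set Y, closed A ->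
    forall f : Y -> Z, {within A, continuous f} ->
      exists (U : set Y) (F : Y -> Z),
        [/\ A `<=` U°, {within U, continuous F} & {in A, F =1 f}].

End ANE.

(* Main.v *)
From HB Require Import structures.
Require Import Defs.
From mathcomp Require Import all_boot all_order all_algebra all_fingroup.
From mathcomp Require Import all_classical all_reals all_analysis.
From mathcomp Require Import lra.

(* Write Z for the enveloping space.  Because G*X is clopen, Z is a finite union
   of clopen copies of X; hence Z has a G-invariant metric, Z^H is locally a
   clopen piece of the ANE's X[g^-1 H g], and every open cover of Z has an open
   refinement of uniformly bounded order.

   Choose invariant covers of Z of mesh 2^-k and order at most M whose members
   are indexed by points z of Z (the stabilizer of a member being that of its
   index), and put the nerves together into a telescope of dimension < 2M which
   approaches Z.  An equivariant map f from a closed invariant A in Y to Z extends,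
   near A, to an equivariant map into Z together with the telescope, by means of
   the open sets {y | d(y, A) < d(y, A minus f^-1 O_z)}, which have the same
   intersection pattern as the f^-1 O_z.  It remains to retract a neighborhood of
   Z in the telescope equivariantly onto Z, one skeleton at a time: an element of
   G mapping a cell to itself fixes it pointwise, so with one cell per orbit the
   extension over the cells of stabilizer H is an instance of Z^H being an ANE,
   and boundedly many steps suffice. *)

Set Implicit Arguments.
Unset Strict Implicit.
Unset Printing Implicit Defensive.

Import Order.TTheory GRing.Theory Num.Theory.
Local Open Scope classical_set_scope.
Local Open Scope ring_scope.

(** * Metrics *)

Section Metrics.
Variable R : realType.

Record is_metric (T : Type) (d : T -> T -> R) : Prop := IsMetric {
  metric_eq0 : forall x y, d x y = 0 <-> x = y;
  metricC : forall x y, d x y = d y x;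
  metricD : forall x y z, d x z <= d x y + d y z
}.

(** The neighborhood filter of [x]. Metrics are plain functions on bare types, so that subsets and
    coordinate spaces need no topological structure. *)
Definition mnear (T : Type) (d : T -> T -> R) (x : T) (P : T -> Prop) : Prop :=
  exists2 e : R, 0 < e & forall y, d x y < e -> P y.

Definition cont_on (S T : Type) (dS : S -> S -> R) (dT : T -> T -> R)
    (A : set S) (f : S -> T) : Prop :=
  forall x, A x -> forall e : R, 0 < e ->
    mnear dS x (fun y => A y -> dT (f x) (f y) < e).

Definition closed_in (T : Type) (d : T -> T -> R) (B C : set T) : Prop :=
  forall x, B x -> ~ C x -> mnear d x (fun y => ~ C y).

Definition nbhd_in (T : Type) (d : T -> T -> R) (B C U : set T) : Prop :=
  forall x, C x -> mnear d x (fun y => B y -> U y).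

Section OneMetric.
Variables (T : Type) (d : T -> T -> R).
Hypothesis dm : is_metric d.

Lemma metricxx x : d x x = 0.
Proof. exact/(metric_eq0 dm). Qed.

Lemma metric_ge0 x y : 0 <= d x y.
Proof.
have := metricD dm x y x; rewrite metricxx (metricC dm y x); lra.
Qed.

Lemma metric_gt0 x y : x <> y -> 0 < d x y.
Proof.
move=> xy; rewrite lt0r metric_ge0 andbT; apply/eqP => /(metric_eq0 dm); exact: xy.
Qed.

Lemma mnearW x (P Q : T -> Prop) :
  (forall y, P y -> Q y) -> mnear d x P -> mnear d x Q.
Proof. by move=> PQ [e e0 eP]; exists e => // y /eP/PQ. Qed.

Lemma mnearT x (P : T -> Prop) : (forall y, P y) -> mnear d x P.
Proof. by move=> PT; exists 1. Qed.

Lemma mnear_self x (P : T -> Prop) : mnear d x P -> P x.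
Proof. by move=> [e e0 eP]; apply: eP; rewrite metricxx. Qed.

Lemma mnear_ball x e : 0 < e -> mnear d x (fun y => d x y < e).
Proof. by move=> e0; exists e. Qed.

Lemma mnearI x (P Q : T -> Prop) :
  mnear d x P -> mnear d x Q -> mnear d x (fun y => P y /\ Q y).
Proof.
move=> [e e0 eP] [f f0 fQ]; exists (Num.min e f).
  by rewrite lt_min e0.
by move=> y; rewrite lt_min => /andP[ye yf]; split; [exact: eP | exact: fQ].
Qed.

Lemma mnear_seq (I : eqType) (s : seq I) x (P : I -> T -> Prop) :
  (forall i, i \in s -> mnear d x (P i)) ->
  mnear d x (fun y => forall i, i \in s -> P i y).
Proof.
elim: s => [|i s IH] nP; first by apply: mnearT.
have nP' : mnear d x (fun y => forall j, j \in s -> P j y).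
  by apply: IH => j js; apply: nP; rewrite in_cons js orbT.
apply: mnearW (mnearI (nP i (mem_head _ _)) nP') => y [Pi Ps] j.
by rewrite in_cons => /orP[/eqP->//|/Ps].
Qed.

Lemma mnear_fin (I : finType) x (P : I -> T -> Prop) :
  (forall i, mnear d x (P i)) -> mnear d x (fun y => forall i, P i y).
Proof.
move=> nP; apply: mnearW (mnear_seq (s := enum I) (fun i _ => nP i)) => y Py i.
by apply: Py; rewrite mem_enum.
Qed.

Lemma mnear_mnear x (P : T -> Prop) :
  mnear d x P -> mnear d x (fun y => mnear d y P).
Proof.
move=> [e e0 eP]; exists (e / 2); first lra.
move=> y xy; exists (e / 2); first lra.
by move=> z yz; apply: eP; have := metricD dm x y z; lra.
Qed.

(* Truncated at 1, which is also the distance to the empty set. *)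
Definition dist1 (S : set T) (y : T) : R := inf ([set d y s | s in S] `|` [set 1]).

Let dist1_has_lbound S y : has_lbound ([set d y s | s in S] `|` [set 1]).
Proof. by exists 0 => _ [[s _ <-]|->] //; exact: metric_ge0. Qed.

Lemma dist1_le1 S y : dist1 S y <= 1.
Proof. by apply: ge_inf => //; right. Qed.

Lemma dist1_le S y s : S s -> dist1 S y <= d y s.
Proof. by move=> Ss; apply: ge_inf => //; left; exists s. Qed.

Lemma dist1_ge S y r : r <= 1 -> (forall s, S s -> r <= d y s) -> r <= dist1 S y.
Proof.
move=> r1 rS; apply: lb_le_inf; first by exists 1; right.
by move=> _ [[s Ss <-]|->] //; exact: rS.
Qed.

Lemma dist1_ge0 S y : 0 <= dist1 S y.
Proof. by apply: dist1_ge => // s _; exact: metric_ge0. Qed.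

Lemma dist1_lt S y r : r <= 1 -> dist1 S y < r -> exists2 s, S s & d y s < r.
Proof.
move=> r1 yr; apply: contrapT => nS.
suff : r <= dist1 S y by lra.
apply: dist1_ge => // s Ss; rewrite leNgt; apply/negP => ys.
by apply: nS; exists s.
Qed.

Lemma dist1_sub S S' y : S `<=` S' -> dist1 S' y <= dist1 S y.
Proof.
by move=> SS; apply: dist1_ge => [|s /SS]; [exact: dist1_le1 | exact: dist1_le].
Qed.

Lemma dist1_tri S y z : dist1 S y <= dist1 S z + d y z.
Proof.
suff : dist1 S y - d y z <= dist1 S z by lra.
apply: dist1_ge => [|s Ss].
  by have := dist1_le1 S y; have := metric_ge0 y z; lra.
by have := dist1_le y Ss; have := metricD dm y z s; lra.
Qed.

Lemma dist1_mem S y : S y -> dist1 S y = 0.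
Proof.
move=> Sy; apply/eqP; rewrite eq_le dist1_ge0 andbT.
by rewrite -(metricxx y); exact: dist1_le.
Qed.

Lemma dist1_gt0 S y : mnear d y (fun z => ~ S z) -> 0 < dist1 S y.
Proof.
move=> [e e0 eS]; apply: (@lt_le_trans _ _ (Num.min e 1)); first by rewrite lt_min e0 ltr01.
apply: dist1_ge => [|s Ss]; first by rewrite ge_min lexx orbT.
by rewrite ge_min leNgt; case: ltP => // /eS/(_ Ss).
Qed.

End OneMetric.

(* For functions bounded by 1; it is at least 0, also when [I] is empty. *)
Definition msup (I : Type) (f : I -> R) : R := sup ([set 0] `|` range f).

Section Msup.
Variables (I : Type).
Implicit Types f g : I -> R.

Lemma msup_ub f i : (forall j, f j <= 1) -> f i <= msup f.
Proof.
move=> f1; apply: ub_le_sup; last by right; exists i.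
by exists 1 => _ [->|[j _ <-]].
Qed.

Lemma msup_le f c : 0 <= c -> (forall i, f i <= c) -> msup f <= c.
Proof.
move=> c0 fc; apply: ge_sup; first by exists 0; left.
by move=> _ [->|[j _ <-]].
Qed.

Lemma msup_ge0 f : (forall j, f j <= 1) -> 0 <= msup f.
Proof.
move=> f1; apply: ub_le_sup; last by left.
by exists 1 => _ [->|[j _ <-]].
Qed.

Lemma msup_gt f r : 0 <= r -> r < msup f -> exists i, r < f i.
Proof.
move=> r0 rf; apply: contrapT => nf.
suff : msup f <= r by lra.
apply: msup_le => // i; rewrite leNgt; apply/negP => fi.
by apply: nf; exists i.
Qed.

Lemma msup_lip f g c : (forall j, f j <= 1) -> (forall j, g j <= 1) ->
  0 <= c -> (forall i, f i <= g i + c) -> msup f <= msup g + c.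
Proof.
move=> f1 g1 c0 fg; have g0 := msup_ge0 g1; apply: msup_le => [|i]; first lra.
by have := msup_ub i g1; have := fg i; lra.
Qed.

End Msup.

(** Gives the invariance of suprema over points, vertices and group elements: reindexing along a
    surjection leaves the range unchanged. *)
Lemma msup_reindex (I : Type) (h h' : I -> I) (f g : I -> R) :
  (forall i, h (h' i) = i) -> (forall i, f (h i) = g i) -> msup f = msup g.
Proof.
move=> hh fg; congr (sup (_ `|` _)); apply/seteqP; split => _ [i _ <-].
  by exists (h' i) => //; rewrite -fg hh.
by exists (h i).
Qed.

Section Dsup.
Variable I : Type.

(** Uniform distance truncated at 1, hence finite for unbounded functions as well. *)
Definition dsup (u v : I -> R) : R := msup (fun i => Num.min 1 `|u i - v i|).

Let min1 (u v : I -> R) i : Num.min 1 `|u i - v i| <= 1.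
Proof. by rewrite ge_min lexx. Qed.

Lemma dsup_le u v c : 0 <= c -> (forall i, `|u i - v i| <= c) -> dsup u v <= c.
Proof. by move=> c0 uv; apply: msup_le => // i; rewrite ge_min uv orbT. Qed.

Lemma dsup_lt u v r i : r <= 1 -> dsup u v < r -> `|u i - v i| < r.
Proof.
move=> r1 uvr; have := msup_ub i (min1 u v); rewrite -/(dsup u v) => h.
by have := le_lt_trans h uvr; rewrite gt_min ltNge r1.
Qed.

Lemma dsup_metric : is_metric dsup.
Proof.
split.
- move=> u v; split => [uv0|->]; last first.
    apply/eqP; rewrite eq_le msup_ge0 // andbT.
    by apply: msup_le => // i; rewrite subrr normr0 ge_min lexx orbT.
  apply/funext => i; apply/eqP; rewrite -subr_eq0 -normr_eq0 eq_le normr_ge0 andbT.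
  have := msup_ub i (min1 u v); rewrite -/(dsup u v) uv0 ge_min => /orP[|//].
  by rewrite leNgt ltr01.
- by move=> u v; congr (msup _); apply/funext => i; rewrite distrC.
- move=> u v w; apply: msup_le => [|i].
    by rewrite addr_ge0 // msup_ge0.
  have h1 := msup_ub i (min1 u v); have h2 := msup_ub i (min1 v w).
  rewrite -/(dsup u v) in h1; rewrite -/(dsup v w) in h2.
  have h3 := ler_normD (u i - v i) (v i - w i).
  have h4 := normr_ge0 (u i - v i); have h5 := normr_ge0 (v i - w i).
  rewrite addrA subrK in h3.
  move: h1 h2; rewrite /Num.min.
  do 3 (case: ltP => ?); lra.
Qed.

End Dsup.

End Metrics.

(** * Equivariant extension over cells *)

Section Actions.
Variables (R : realType) (gT : finGroupType).

Record act_laws (T : Type) (a : gT -> T -> T) : Prop := ActLaws {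
  act_one : forall x, a 1%g x = x;
  act_mul : forall g h x, a g (a h x) = a (g * h)%g x
}.

Definition isometric (T : Type) (d : T -> T -> R) (a : gT -> T -> T) : Prop :=
  forall g x y, d (a g x) (a g y) = d x y.

Definition fixset (T : Type) (a : gT -> T -> T) (H : {group gT}) : set T :=
  [set x | forall h, h \in H -> a h x = x].

Lemma actKg (T : Type) (a : gT -> T -> T) : act_laws a ->
  forall g x, a g^-1%g (a g x) = x.
Proof. by move=> aA g x; rewrite act_mul // mulVg act_one. Qed.

Lemma actKVg (T : Type) (a : gT -> T -> T) : act_laws a ->
  forall g x, a g (a g^-1%g x) = x.
Proof. by move=> aA g x; rewrite act_mul // mulgV act_one. Qed.

Lemma mnear_act (T : Type) (d : T -> T -> R) (a : gT -> T -> T) g x P :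
  isometric d a -> mnear d (a g x) P -> mnear d x (fun y => P (a g y)).
Proof. by move=> ai [e e0 eP]; exists e => // y xy; apply: eP; rewrite ai. Qed.

Lemma fixset_closed (T : Type) (d : T -> T -> R) (a : gT -> T -> T) H x :
  is_metric d -> isometric d a -> ~ fixset a H x ->
  mnear d x (fun y => ~ fixset a H y).
Proof.
move=> dm ai /existsNP[h /not_implyP[hH hx]].
have hx0 : 0 < d (a h x) x by exact: metric_gt0.
exists (d (a h x) x / 2); first lra.
move=> y xy /(_ h hH) hy.
have := metricD dm (a h x) (a h y) x; rewrite ai hy (metricC dm y x); lra.
Qed.

(** The ANE property of the subspace [S], phrased with subsets only: the test pair is [C] closed in
    [B], and maps into [S] are maps into [Z] with values in [S]. *)
Definition ext_property (Z : Type) (dZ : Z -> Z -> R) (S : set Z) : Prop :=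
  forall (Y : Type) (dY : Y -> Y -> R), is_metric dY ->
  forall B C : set Y, C `<=` B -> closed_in dY B C ->
  forall f : Y -> Z, cont_on dY dZ C f -> (forall y, C y -> S (f y)) ->
  exists (U : set Y) (F : Y -> Z),
    [/\ U `<=` B, C `<=` U, nbhd_in dY B C U, cont_on dY dZ U F &
        (forall y, U y -> S (F y)) /\ (forall y, C y -> F y = f y)].

Section Step.
Variables (L Z : Type) (dL : L -> L -> R) (dZ : Z -> Z -> R).
Variables (aL : gT -> L -> L) (aZ : gT -> Z -> Z).
Hypothesis dLm : is_metric dL.
Hypotheses (aLA : act_laws aL) (aZA : act_laws aZ).
Hypotheses (aLi : isometric dL aL) (aZi : isometric dZ aZ).
Hypothesis extZ : forall H : {group gT}, ext_property dZ (fixset aZ H).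
Variables (Sg : choiceType) (aS : gT -> Sg -> Sg) (s0 : Sg).
Hypothesis aSA : act_laws aS.

(** The choice is made from the orbit as a set, so all points of an orbit get the same
    representative. *)
Definition orbit_rep (s : Sg) : Sg := xget s0 [set t | exists g, aS g s = t].

Definition orbit_tr (s : Sg) : gT := xget 1%g [set g | aS g (orbit_rep s) = s].

Lemma orbit_repP s : exists g, aS g s = orbit_rep s.
Proof.
rewrite /orbit_rep; case: xgetP => [t _ //|/(_ s)] nE.
by exfalso; apply: nE; exists 1%g; rewrite act_one.
Qed.

Lemma orbit_rep_act g s : orbit_rep (aS g s) = orbit_rep s.
Proof.
congr (xget s0); apply/seteqP; split => t [h <-].
  by exists (h * g)%g; rewrite act_mul.
by exists (h * g^-1)%g; rewrite act_mul // mulgKV.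
Qed.

Lemma orbit_trP s : aS (orbit_tr s) (orbit_rep s) = s.
Proof.
rewrite /orbit_tr; case: xgetP => [g _ //|]; have [g gs] := orbit_repP s.
by move=> /(_ g^-1%g); rewrite /= -gs actKg // => /(_ erefl).
Qed.

Lemma orbit_rep_idem s : orbit_rep (orbit_rep s) = orbit_rep s.
Proof. by have [g gs] := orbit_repP s; rewrite -{1}gs orbit_rep_act. Qed.

Definition stab_set (t : Sg) : {set gT} := [set g | aS g t == t]%SET.

Lemma stab_group_set t : group_set (stab_set t).
Proof.
apply/group_setP; split => [|g h]; first by rewrite inE act_one.
by rewrite !inE => /eqP gt /eqP ht; rewrite -act_mul // ht gt.
Qed.

Canonical stab_group t := Group (stab_group_set t).

(** [P] is the stage already built, [W] the union of the cells being added, [sigma] the label of the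
    cell of a point. For each subgroup [K], [F] is extended over the representative cells of
    stabilizer [K], with values in the [K]-fixed points of [Z]; the group then carries these
    extensions to the other cells. *)
Lemma equivariant_step (P W : set L) (sigma : L -> Sg) (U : set L) (F : L -> Z) :
  invariant_set aL W ->
  (forall u, W u -> mnear dL u (fun v => ~ P v /\ (W v -> sigma v = sigma u))) ->
  equivariant_on aL aS W sigma ->
  (forall g u, W u -> aS g (sigma u) = sigma u -> aL g u = u) ->
  U `<=` P -> invariant_set aL U -> cont_on dL dZ U F -> equivariant_on aL aZ U F ->
  exists (U' : set L) (F' : L -> Z),
    [/\ U `<=` U' /\ U' `<=` U `|` W, invariant_set aL U', nbhd_in dL (U `|` W) U U',
        cont_on dL dZ U' F' &
        equivariant_on aL aZ U' F' /\ (forall u, U u -> F' u = F u)].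
Proof.
move=> Winv Wnear sW Wstab UP Uinv Fc Fe.
pose tr u := orbit_tr (sigma u); pose rep u := orbit_rep (sigma u).
pose H u : {group gT} := stab_group (rep u).
(* The translate of [u] that lies in the representative cell of its orbit. *)
pose red u := aL (tr u)^-1%g u.
have WP u : W u -> ~ P u by move=> /Wnear/(mnear_self dLm)[].
have Wred u : W u -> W (red u) by exact: Winv.
have s_red u : W u -> sigma (red u) = rep u.
  by move=> Wu; rewrite /red sW // -{1}(orbit_trP (sigma u)) actKg.
have rep_red u : W u -> rep (red u) = rep u.
  by move=> Wu; rewrite /rep s_red // orbit_rep_idem.
have fix_red u : W u -> fixset aL (H u) (red u).
  move=> Wu h; rewrite inE => /eqP hu; apply: Wstab; first exact: Wred.
  by rewrite s_red.
(* The extension problem for [K]: from the [K]-fixed part of [U] to the representative cells of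
   stabilizer [K]. *)
pose C (K : {group gT}) := U `&` fixset aL K.
pose B (K : {group gT}) := C K `|` [set u | [/\ W u, sigma u = rep u & H u = K]].
have Bred u : W u -> B (H u) (red u).
  move=> Wu; right; split; [exact: Wred | by rewrite s_red // rep_red |].
  by rewrite /H rep_red.
have ex K : exists p : set L * (L -> Z),
    [/\ p.1 `<=` B K, C K `<=` p.1, nbhd_in dL (B K) (C K) p.1, cont_on dL dZ p.1 p.2 &
        (forall y, p.1 y -> fixset aZ K (p.2 y)) /\ (forall y, C K y -> p.2 y = F y)].
  have [] := @extZ K L dL dLm (B K) (C K) _ _ F; last by move=> V [G VG]; exists (V, G).
  - by move=> u Cu; left.
  - move=> u [//|[Wu _ _]] _; apply: mnearW (Wnear _ Wu) => v [nPv _].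
    by move=> [/UP].
  - move=> u [Uu _] e e0; apply: mnearW (Fc _ Uu _ e0) => v Fv [Uv _]; exact: Fv.
  - by move=> u [Uu fu] h hK; rewrite -Fe // fu.
have {ex} [p pP] := choice ex.
pose V := [set u | W u /\ (p (H u)).1 (red u)].
pose F' u := if `[< U u >] then F u else aZ (tr u) ((p (H u)).2 (red u)).
have F'U u : U u -> F' u = F u by move=> Uu; rewrite /F'; case: asboolP.
have F'W u : W u -> F' u = aZ (tr u) ((p (H u)).2 (red u)).
  by move=> /WP nPu; rewrite /F'; case: asboolP => // /UP.
(* The transporters of [u] and of its translate differ by an element of the stabilizer, which fixes
   [red u] and the value of the extension there; equivariance of [F'] follows. *)
have red_act g u : W u -> [/\ H (aL g u) = H u, red (aL g u) = red u &
    exists2 k, k \in H u & tr (aL g u) = (g * tr u * k^-1)%g].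
  move=> Wu; have rE : rep (aL g u) = rep u by rewrite /rep sW // orbit_rep_act.
  pose k := ((tr (aL g u))^-1 * g * tr u)%g.
  have kH : k \in H u.
    rewrite inE /k -!act_mul // /tr orbit_trP -sW // -rE.
    by rewrite -{2}(orbit_trP (sigma (aL g u))) actKg.
  split; first by rewrite /H rE.
  - rewrite -[RHS](fix_red _ Wu _ kH) /k /red !act_mul //.
    by rewrite -!mulgA mulgV mulg1.
  - by exists k => //; rewrite /k !invMg invgK !mulgA mulgK mulgV mul1g.
have local u e : U u -> 0 < e -> mnear dL u (fun v => W v ->
    (p (H v)).1 (red v) /\ dZ (F u) (F' v) < e).
  move=> Uu e0.
  suff : mnear dL u (fun v => forall gK : gT * {group gT}, W v -> tr v = gK.1 -> H v = gK.2 ->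
      (p gK.2).1 (aL gK.1^-1%g v) /\
      dZ (aZ gK.1^-1%g (F u)) ((p gK.2).2 (aL gK.1^-1%g v)) < e).
    apply: mnearW => v /(_ (tr v, H v)) /= h Wv; have [//|//|//|h1 h2] := h.
    by split => //; rewrite F'W // -(aZi (tr v)^-1%g) actKg.
  apply: mnear_fin => -[g K] /=.
  (* Only finitely many pairs of a transporter [g] and a stabilizer [K] occur. If [g^-1 u] is not
     fixed by [K], closedness of the fixed set excludes the pair near [u]; otherwise [g^-1 u] lies
     in [C K], where the extension agrees with [F]. *)
  have [cC|ncC] := pselect (fixset aL K (aL g^-1%g u)); last first.
    apply: mnearW (mnear_act aLi (fixset_closed dLm aLi ncC)) => v nf Wv tv Hv.
    by exfalso; apply: nf; rewrite -Hv -tv; exact: fix_red.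
  have [_ Cp pn pc [_ pF]] := pP K.
  have CK : C K (aL g^-1%g u) by split => //; exact: Uinv.
  have n1 := mnear_act aLi (pn _ CK).
  have n2 := mnear_act aLi (pc _ (Cp _ CK) _ e0).
  apply: mnearW (mnearI n1 n2) => v [v1 v2] Wv tv Hv.
  have pv : (p K).1 (aL g^-1%g v) by apply: v1; rewrite -Hv -tv; exact: Bred.
  by split => //; move: (v2 pv); rewrite pF // Fe.
exists (U `|` V), F'; split.
- by split => u; [left | move=> [|[]]; [left | right]].
- move=> g u [Uu|[Wu pu]]; first by left; exact: Uinv.
  by right; have [E1 E2 _] := red_act g u Wu; split; [exact: Winv | rewrite E1 E2].
- move=> u Uu; apply: mnearW (local u 1 Uu ltr01) => v h [|Wv]; first by left.
  by right; split => //; have [] := h Wv.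
- move=> u [Uu|[Wu pu]] e e0.
    apply: mnearW (mnearI (Fc _ Uu _ e0) (local u e Uu e0)) => v [h1 h2].
    rewrite F'U // => -[Uv|[Wv _]]; first by rewrite F'U //; exact: h1.
    by have [] := h2 Wv.
  (* Since [sigma] is locally constant on [W], near [u] the map [F'] is a single extension moved by
     a single group element. *)
  have [_ _ _ pc _] := pP (H u).
  have n1 := mnear_act aLi (pc _ pu _ e0).
  apply: mnearW (mnearI (Wnear _ Wu) n1) => v [[nPv sv] h] [/UP//|[Wv pv]].
  have E : sigma v = sigma u by exact: sv.
  rewrite !F'W // /red /H /rep /tr E aZi; apply: h.
  by move: pv; rewrite /red /H /rep /tr E.
- split => // g u [Uu|[Wu pu]]; first by rewrite !F'U ?Fe //; exact: Uinv.
  have [E1 E2 [k kH E3]] := red_act g u Wu.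
  rewrite !F'W //; last exact: Winv.
  have [_ _ _ _ [pf _]] := pP (H u).
  have fz : aZ k^-1%g ((p (H u)).2 (red u)) = (p (H u)).2 (red u).
    by apply: (pf _ pu); rewrite groupV.
  by rewrite E1 E2 E3 -!act_mul // fz.
Qed.

End Step.
End Actions.

(** * The telescope of nerves *)

Section Nerve.
Variables (R : realType) (gT : finGroupType) (Z : choiceType).
Variables (dZ : Z -> Z -> R) (aZ : gT -> Z -> Z).

(** The members are indexed by all of [Z] and may be empty; [gc_good] makes translates with distinct
    indices disjoint. *)
Record good_cover (O : Z -> set Z) (eps : R) (M : nat) : Prop := GoodCover {
  gc_open : forall z w, O z w -> mnear dZ w (O z);
  gc_cover : forall w, exists z, O z w;
  gc_act : forall g z w, O z w -> O (aZ g z) (aZ g w);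
  gc_good : forall g z w, O z w -> O (aZ g z) w -> aZ g z = z;
  gc_size : forall z w, O z w -> dZ z w < eps;
  gc_order : forall w, exists2 l : seq Z, (size l <= M)%N & forall z, O z w -> z \in l
}.

Hypotheses (dZm : is_metric dZ) (aZA : act_laws aZ) (aZi : isometric dZ aZ).

Definition vertex : choiceType := (Z * nat)%type.
(** The [inl] coordinates record a position through its distances to the points of [Z], the [inr]
    coordinates the weights of the vertices. *)
Definition coords : Type := ((Z + vertex) -> R)%type.

Definition act_vertex (g : gT) (v : vertex) : vertex := (aZ g v.1, v.2).
Definition act_index (g : gT) (i : Z + vertex) : Z + vertex :=
  match i with inl z => inl (aZ g z) | inr v => inr (act_vertex g v) end.
Definition act_coords (g : gT) (u : coords) : coords := fun i => u (act_index g^-1%g i).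
Definition act_label (g : gT) (s : set vertex) : set vertex :=
  [set v | s (act_vertex g^-1%g v)].

Lemma act_vertex_laws : act_laws act_vertex.
Proof.
split=> [[z k]|g h [z k]]; first by rewrite /act_vertex /= act_one.
by rewrite /act_vertex /= act_mul.
Qed.

Lemma act_index_laws : act_laws act_index.
Proof.
split=> [[z|v]|g h [z|v]] /=; first by rewrite act_one.
- by rewrite (act_one act_vertex_laws).
- by rewrite act_mul.
- by rewrite (act_mul act_vertex_laws).
Qed.

Lemma act_coords_laws : act_laws act_coords.
Proof.
split=> [u|g h u]; apply/funext => i; rewrite /act_coords.
  by rewrite invg1 (act_one act_index_laws).
by rewrite (act_mul act_index_laws) invMg.
Qed.

Lemma act_label_laws : act_laws act_label.
Proof.
split=> [s|g h s]; apply/funext => v; rewrite /act_label /=.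
  by rewrite invg1 (act_one act_vertex_laws).
by rewrite (act_mul act_vertex_laws) invMg.
Qed.

Lemma act_coords_isometric : isometric (@dsup R (Z + vertex)) act_coords.
Proof.
move=> g u v; apply: (@msup_reindex _ _ (act_index g) (act_index g^-1%g)) => i.
  exact: (actKVg act_index_laws).
by rewrite /act_coords (actKg act_index_laws).
Qed.

(* Kuratowski embedding. *)
Definition kappa (z : Z) : coords :=
  fun i => match i with inl w => dZ z w | inr _ => 0 end.

Lemma kappa_act g z : act_coords g (kappa z) = kappa (aZ g z).
Proof.
apply/funext => -[w|v] //; rewrite /act_coords /= -(aZi g).
by rewrite actKVg.
Qed.

Lemma kappa_near z w e : e <= 1 -> dsup (kappa z) (kappa w) < e -> dZ z w < e.
Proof.
move=> e1 /(dsup_lt (inl w) e1) /=.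
by rewrite (metricxx dZm) subr0 ger0_norm // (metric_ge0 dZm).
Qed.

Lemma kappa_inj : injective kappa.
Proof.
move=> z w zw; apply/(metric_eq0 dZm).
by have := congr1 (@^~ (inl w)) zw; rewrite /= (metricxx dZm).
Qed.

Variables (O : nat -> Z -> set Z) (M : nat) (epsk : nat -> R).
Hypothesis gO : forall k, good_cover (O k) (epsk k) M.

(** The nerve of all levels jointly: the members share a point, whatever their levels. *)
Definition simplex (s : set vertex) : Prop :=
  exists w, forall v, s v -> O v.2 v.1 w.

Definition supp (u : coords) : set vertex := [set v | u (inr v) <> 0].

(* The last clause says that the [inl] coordinates depend equivariantly on the
   [inr] coordinates; no normalization of the latter is needed. *)
Definition open_cell (n : nat) : set coords := [set u |
  [/\ exists l : seq vertex, [/\ uniq l, size l = n & forall v, supp u v <-> v \in l],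
      simplex (supp u) &
      forall g, (forall v, supp u v -> act_vertex g v = v) -> act_coords g u = u]].

(** The index counts vertices rather than dimension; stage 0 is the embedded copy of [Z]. *)
Fixpoint skeleton (n : nat) : set coords :=
  if n is n'.+1 then skeleton n' `|` open_cell n'.+1 else range kappa.

Lemma open_cell_inv n : invariant_set act_coords (open_cell n).
Proof.
move=> g u [[l [ul sl lP]] [w wP] fP]; split.
- exists (map (act_vertex g) l); split.
  + by rewrite map_inj_uniq //; exact: (can_inj (actKg act_vertex_laws g)).
  + by rewrite size_map.
  + move=> v; rewrite /supp /= /act_coords /=.
    rewrite -{2}(actKVg act_vertex_laws g v) mem_map; first exact: lP.
    exact: (can_inj (actKg act_vertex_laws g)).
- exists (aZ g w) => v /wP /= Ow.
  by have := gc_act (gO v.2) g Ow; rewrite actKVg.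
- move=> h hP; rewrite -[LHS](actKVg act_coords_laws g); congr (act_coords g _).
  rewrite !(act_mul act_coords_laws); apply: fP => v vu.
  rewrite -!(act_mul act_vertex_laws) hP ?(actKg act_vertex_laws) //.
  by rewrite /supp /= /act_coords /= (actKg act_vertex_laws).
Qed.

Lemma skeleton_supp n u : skeleton n u ->
  exists2 l : seq vertex, (size l <= n)%N & forall v, supp u v -> v \in l.
Proof.
elim: n => [[z _ <-]|n IH /= [/IH[l sl lP]|[[l [_ sl lP]] _ _]]].
- by exists [::] => // v.
- by exists l => //; exact: leqW.
- by exists l; rewrite ?sl // => v /lP.
Qed.

(** Nonzero weights stay nonzero nearby, so supports can only grow; [n.+1] vertices are too many for
    [skeleton n] and leave no room for growth in [open_cell n.+1]. *)
Lemma open_cell_near n u : open_cell n.+1 u ->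
  mnear (@dsup R _) u (fun v => ~ skeleton n v /\ (open_cell n.+1 v -> supp v = supp u)).
Proof.
move=> [[l [ul sl lP]] _ _].
have near_l : mnear (@dsup R _) u (fun u' => forall v, v \in l -> supp u' v).
  apply: mnear_seq => v /lP vu.
  have u0 : 0 < `|u (inr v)| by rewrite normr_gt0; apply/eqP.
  exists (Num.min 1 `|u (inr v)|); first by rewrite lt_min ltr01.
  move=> u' /(dsup_lt (inr v)); rewrite ge_min lexx => /(_ isT).
  by rewrite lt_min => /andP[_ lt] E; move: lt; rewrite E subr0 ltxx.
apply: mnearW near_l => u' u'l; split.
  move=> /skeleton_supp[l' sl' l'P].
  suff : (size l <= size l')%N by rewrite sl leqNgt ltnS sl'.
  by apply: uniq_leq_size => // v /u'l/l'P.
move=> [[l' [ul' sl' l'P]] _ _]; apply/seteqP.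
have ll' : {subset l <= l'} by move=> v /u'l/l'P.
have [|_ eql] := uniq_min_size ul ll'; first by rewrite sl sl'.
by split => v => [/l'P|/lP]; rewrite -?eql => ?; [apply/lP | apply/l'P; rewrite -eql].
Qed.

(** A vertex of the cell and its image have the same level and lie in one simplex, so they coincide
    by [gc_good]; the last clause of [open_cell] then fixes the point. *)
Lemma cell_stab n u g : open_cell n u -> act_label g (supp u) = supp u ->
  act_coords g u = u.
Proof.
move=> [_ [w wP] fP] E; apply: fP => v vu.
have gvu : supp u (act_vertex g v).
  by rewrite -E /act_label /= (actKg act_vertex_laws).
by case: v vu gvu => z k /wP /= h1 /wP /= h2; rewrite /act_vertex /= (gc_good (gO k) h1 h2).
Qed.

Hypothesis extZ : forall H : {group gT}, ext_property dZ (fixset aZ H).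

(** Induction from the inverse of [kappa], each step being [equivariant_step] with the previous
    skeleton as [P], the open cells as [W] and the support as label. *)
Lemma skeleton_retraction (z0 : Z) n : exists (U : set coords) (r : coords -> Z),
  [/\ U `<=` skeleton n, range kappa `<=` U /\ invariant_set act_coords U,
      nbhd_in (@dsup R _) (skeleton n) (range kappa) U,
      cont_on (@dsup R _) dZ U r &
      equivariant_on act_coords aZ U r /\ forall z, r (kappa z) = z].
Proof.
elim: n => [|n [U [r [US [kU Ui] Un rc [re rk]]]]].
  pose r u := xget z0 [set z | kappa z = u].
  have rk z : r (kappa z) = z.
    by rewrite /r; case: xgetP => [w _ /kappa_inj //|/(_ z erefl)].
  exists (range kappa), r; split => //.
  - by split => // g _ [z _ <-]; exists (aZ g z) => //; rewrite kappa_act.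
  - by move=> u ku; exact: mnearT.
  - move=> _ [z _ <-] e e0; exists (Num.min e 1); first by rewrite lt_min e0 ltr01.
    move=> v lt [w _ wv]; move: lt; rewrite -wv !rk => lt.
    have := kappa_near _ lt; rewrite ge_min lexx orbT lt_min => /(_ isT).
    by move=> /andP[].
  - by split => // g _ [z _ <-]; rewrite kappa_act !rk.
have [//|g u Wu|U' [r' [[UU' U'W] Ui' Un' rc' [re' rr']]]] :=
  equivariant_step (@dsup_metric R _) act_coords_laws aZA act_coords_isometric
    aZi extZ (set0 : set vertex) act_label_laws
    (@open_cell_inv n.+1) (@open_cell_near n) _ _ US Ui rc re.
  exact: cell_stab Wu.
exists U', r'; split => //.
- by move=> u /U'W [/US|]; [left | right].
- by split => // u /kU/UU'.
- move=> u ku; apply: mnearW (mnearI (Un u ku) (Un' u (kU _ ku))) => v [h1 h2] [Sv|Wv].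
    by apply: h2; left; exact: h1.
  by apply: h2; right.
- by split => // z; rewrite rr' //; apply: kU; exists z.
Qed.

End Nerve.

(** * Mapping into the telescope *)

(** A duplicate-free list in [P] of maximal length exhausts [P]. *)
Lemma bounded_enum (T : eqType) (P : T -> Prop) (n : nat) :
  (forall s : seq T, uniq s -> (forall v, v \in s -> P v) -> (size s <= n)%N) ->
  exists l : seq T, [/\ uniq l, (size l <= n)%N & forall v, P v <-> v \in l].
Proof.
move=> bP.
pose Q m := `[< exists s : seq T, [/\ uniq s, size s = m & forall v, v \in s -> P v] >].
have Q0 : exists m, Q m by exists 0; apply/asboolP; exists [::].
have Qn m : Q m -> (m <= n)%N by move=> /asboolP[s [us <-]]; exact: bP.
have [m /asboolP[s [us sm sP]] mM] := ex_maxnP Q0 Qn.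
exists s; split=> // [|v]; first exact: bP.
split=> [Pv|/sP//]; apply: contrapT => /negP vs.
suff /mM : Q m.+1 by rewrite ltnn.
apply/asboolP; exists (v :: s); split; rewrite ?[uniq _]/= ?vs //= ?sm //.
by move=> w; rewrite in_cons => /orP[/eqP->//|/sP].
Qed.

Lemma half_pow_lt (R : realType) (e : R) : 0 < e -> exists k, 2^-1 ^+ k < e.
Proof.
move=> e0; have [k ke] : exists k : nat, e^-1 < k%:R.
  by exists (Num.truncn e^-1).+1; rewrite truncnS_gt.
exists k; rewrite exprVn invf_plt ?posrE // ?exprn_gt0 //.
by apply: (lt_trans ke); rewrite -natrX ltr_nat ltn_expl.
Qed.

Section MinMax.
Variable R : realDomainType.
Implicit Types a b c : R.

Lemma min_tri a b a' b' c : a <= a' + c -> b <= b' + c ->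
  Num.min a b <= Num.min a' b' + c.
Proof. by move=> ha hb; rewrite ge_min /Num.min; case: ltP => ?; rewrite ?ha ?hb ?orbT. Qed.

Lemma max_tri a b a' b' c : a <= a' + c -> b <= b' + c ->
  Num.max a b <= Num.max a' b' + c.
Proof.
move=> ha hb; rewrite ge_max; apply/andP; split.
  by apply: le_trans ha _; rewrite lerD2r le_max lexx.
by apply: le_trans hb _; rewrite lerD2r le_max lexx orbT.
Qed.

End MinMax.

Section NerveMap.
Variables (R : realType) (gT : finGroupType) (Z : choiceType).
Variables (dZ : Z -> Z -> R) (aZ : gT -> Z -> Z).
Hypotheses (dZm : is_metric dZ) (aZA : act_laws aZ) (aZi : isometric dZ aZ).
Hypothesis dZ1 : forall z w, dZ z w <= 1.
Variables (O : nat -> Z -> set Z) (M : nat).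
Hypothesis gO : forall k, good_cover dZ aZ (O k) (2^-1 ^+ k) M.

Variables (Y : Type) (dY : Y -> Y -> R) (aY : gT -> Y -> Y).
Hypotheses (dYm : is_metric dY) (aYA : act_laws aY) (aYi : isometric dY aY).
Variables (A : set Y) (f : Y -> Z).
Hypotheses (Acl : closed_in dY setT A) (Ainv : invariant_set aY A).
Hypotheses (fc : cont_on dY dZ A f) (fe : equivariant_on aY aZ A f).

Let V := vertex Z.
Implicit Types (y : Y) (v : V) (k : nat).

Let D y : R := dist1 dY A y.
Let off v : set Y := [set a | A a /\ ~ O v.2 v.1 (f a)].
Let e v y : R := dist1 dY (off v) y.
(** Positive exactly where [d(y, A) < d(y, A minus f^-1 O_v)], with distances truncated at 1. *)
Let beta v y : R := e v y - D y.
Let B k y : R := msup (fun z => beta (z, k) y).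

(** Since [psi k] stays below [B k], [D y < psi k y] provides a vertex of level [k] with positive
    [beta] at [y]; the halving makes [psi k] tend to 0. *)
Let psi : nat -> Y -> R := fix psi k y :=
  if k is k'.+1 then Num.min (B k y) (psi k' y / 2) else B 0%N y.

(* Positive only where [D < psi k] and [psi k.+1 < 2 D], which happens for at
   most two consecutive [k] since [psi] at least halves at each step. *)
Let wt k y : R := Num.min (psi k y - D y) (2 * D y - psi k.+1 y).
Let alpha v y : R := Num.max 0 (Num.min (wt v.2 y) (beta v y)).
Let mu y : R := msup (alpha^~ y).
Let S y x : R := msup (fun v => alpha v y * dZ v.1 x).

Definition nerve_dom : set Y := [set y | D y < psi 0%N y].

(* The position [S / mu] is a normalized maximum rather than a barycentric
   combination: a supremum of uniformly Lipschitz functions is Lipschitz, so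
   local finiteness of the [alpha v] plays no role. *)
Definition nerve_map y : coords R Z :=
  if `[< A y >] then kappa dZ (f y)
  else fun i => match i with inl x => S y x / mu y | inr v => alpha v y end.

Let D0 y : 0 <= D y. Proof. exact: dist1_ge0. Qed.
Let e1 v y : e v y <= 1. Proof. exact: dist1_le1. Qed.
Let De v y : D y <= e v y. Proof. by apply: dist1_sub => // a []. Qed.
Let beta1 v y : beta v y <= 1.
Proof. by rewrite /beta; have := D0 y; have := e1 v y; lra. Qed.

Let B_ge v y : beta v y <= B v.2 y.
Proof. by case: v => z k; apply: (@msup_ub _ _ (fun z => beta (z, k) y)). Qed.

Let B0 k y : 0 <= B k y. Proof. exact: msup_ge0. Qed.
Let B1 k y : B k y <= 1. Proof. exact: msup_le. Qed.

Let psi_B k y : psi k y <= B k y.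
Proof. by case: k => [|k] /=; rewrite ?ge_min lexx. Qed.

Let psi_half k y : psi k.+1 y <= psi k y / 2.
Proof. by rewrite /= ge_min lexx orbT. Qed.

Let psi0 k y : 0 <= psi k y.
Proof. by elim: k => [|k IH] /=; rewrite ?B0 // le_min B0 divr_ge0. Qed.

Let psi_anti j k y : (j <= k)%N -> psi k y <= psi j y.
Proof.
elim: k => [|k IH]; first by rewrite leqn0 => /eqP->.
rewrite leq_eqVlt => /orP[/eqP->//|/IH h].
by have := psi_half k y; have := psi0 k y; lra.
Qed.

Let psi_pow k y : psi k y <= 2^-1 ^+ k.
Proof.
elim: k => [|k IH]; first by rewrite expr0 /=.
by have := psi_half k y; rewrite exprS; lra.
Qed.

Let alpha0 v y : 0 <= alpha v y. Proof. by rewrite le_max lexx. Qed.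

Let alpha_le v y : alpha v y <= 2 * D y.
Proof.
rewrite ge_max mulr_ge0 //= ge_min /wt ge_min orbC; apply/orP; right.
by apply/orP; right; have := psi0 v.2.+1 y; lra.
Qed.

Let alpha1 v y : alpha v y <= 1.
Proof. by rewrite ge_max ler01 ge_min beta1 orbT. Qed.

Let alpha_gt0 v y : 0 < alpha v y ->
  [/\ D y < psi v.2 y, psi v.2.+1 y < 2 * D y & D y < e v y].
Proof. by rewrite lt_max ltxx /= !lt_min !subr_gt0 => /andP[/andP[-> ->] ->]. Qed.

Let alpha_eq0 v y : alpha v y = 0 \/ 0 < alpha v y.
Proof. by have := alpha0 v y; rewrite le_eqVlt => /orP[/eqP|]; [left|right]. Qed.

Let D_tri y z : D y <= D z + dY y z. Proof. exact: dist1_tri. Qed.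

Let beta_tri v y z : beta v y <= beta v z + 2 * dY y z.
Proof.
have := D_tri z y; have := dist1_tri dYm (off v) y z.
by rewrite (metricC dYm z y) /beta /e; lra.
Qed.

Let psi_tri k y z : psi k y <= psi k z + 2 * dY y z.
Proof.
have d0 := metric_ge0 dYm y z.
have Bt j : B j y <= B j z + 2 * dY y z by apply: msup_lip => //; lra.
elim: k => [|k IH]; first exact: Bt.
apply: (@min_tri _ _ (psi k y / 2) _ (psi k z / 2)); [exact: Bt | lra].
Qed.

(** The constant 4 comes from [2 * D - psi], where [D] has Lipschitz constant 1 and [psi] has 2. *)
Let alpha_tri v y z : alpha v y <= alpha v z + 4 * dY y z.
Proof.
have d0 := metric_ge0 dYm y z.
have h1 := D_tri y z; have h2 := D_tri z y.
have h3 := psi_tri v.2 y z; have h4 := psi_tri v.2.+1 z y.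
have h5 := beta_tri v y z.
rewrite (metricC dYm z y) in h2 h4.
apply: max_tri; first lra.
apply: min_tri; last lra.
by apply: min_tri; lra.
Qed.

Let S_tri y z x : S y x <= S z x + 4 * dY y z.
Proof.
have d0 := metric_ge0 dYm y z.
have b1 y' v : alpha v y' * dZ v.1 x <= 1.
  by rewrite mulr_ile1 // (metric_ge0 dZm).
apply: msup_lip => // [|v]; first lra.
have := alpha_tri v y z; have := dZ1 v.1 x; have := metric_ge0 dZm v.1 x.
nra.
Qed.

Let mu_tri y z : mu y <= mu z + 4 * dY y z.
Proof.
by have d0 := metric_ge0 dYm y z; apply: msup_lip => //; lra.
Qed.

Let S_ge0 y x : 0 <= S y x.
Proof.
apply: msup_ge0 => v; rewrite mulr_ile1 // (metric_ge0 dZm) //.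
Qed.

Let S_ub v y x : alpha v y * dZ v.1 x <= S y x.
Proof.
apply: (@msup_ub _ _ (fun v => alpha v y * dZ v.1 x)) => j.
by rewrite mulr_ile1 // (metric_ge0 dZm).
Qed.

Let mu0 y : 0 <= mu y. Proof. exact: msup_ge0. Qed.
Let mu_ub v y : alpha v y <= mu y. Proof. exact: (@msup_ub _ _ (alpha^~ y)). Qed.

Let S_le_mu y x : S y x <= mu y.
Proof.
apply: msup_le => // v; apply: le_trans (mu_ub v y).
by rewrite ler_piMr.
Qed.

Let D_A y : A y -> D y = 0. Proof. exact: dist1_mem. Qed.

Let D_gt0 y : ~ A y -> 0 < D y.
Proof. by move=> nAy; apply: dist1_gt0 => //; exact: Acl. Qed.

(** On [A] the distance [D] vanishes, and if a member of level [j] contains [f y], continuity of [f]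
    keeps its set [off] at positive distance from [y]. *)
Let psi_A k y : A y -> 0 < psi k y.
Proof.
move=> Ay; have Bgt j : 0 < B j y.
  have [z Oz] := gc_cover (gO j) (f y).
  apply: lt_le_trans (B_ge (z, j) y); rewrite /beta D_A // subr0.
  apply: dist1_gt0 => //.
  have [r r0 rO] := gc_open (gO j) Oz.
  by apply: mnearW (fc Ay r0) => y' h [Ay' nO]; apply: nO; apply: rO; exact: h.
by elim: k => [|k IH] //=; rewrite lt_min Bgt divr_gt0.
Qed.

(** As [D y > 0] and [psi] tends to 0, there is a first index with [psi <= D]; it is not 0 on
    [nerve_dom], and [k] is its predecessor. *)
Let level y : nerve_dom y -> ~ A y -> exists k, D y < psi k y /\ psi k.+1 y <= D y.
Proof.
move=> yN nAy; have [j jD] := half_pow_lt (D_gt0 nAy).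
have ex : exists j, psi j y <= D y by exists j; apply: le_trans (ltW jD).
case: (ex_minnP ex) => -[|k] kD km; first by move: yN; rewrite /nerve_dom /= ltNge kD.
exists k; split => //; rewrite ltNge; apply/negP => /km; by rewrite ltnn.
Qed.

(** A level above [k] would have [psi <= D] by monotonicity. A level below [k.-1] leaves one more
    halving between [psi v.2.+1 < 2 * D] and [psi k], forcing [psi k < D]. *)
Let level_uniq y k v : psi k.+1 y <= D y -> D y < psi k y -> 0 < alpha v y ->
  v.2 = k \/ v.2 = k.-1.
Proof.
move=> h1 h2 /alpha_gt0[h3 h4 _].
have lk : (v.2 <= k)%N.
  rewrite leqNgt; apply/negP => kv; have := psi_anti y kv; lra.
have kl : (k <= v.2.+1)%N.
  rewrite leqNgt; apply/negP => kv; have := psi_anti y kv.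
  by have := psi_half v.2.+1 y; lra.
move: lk kl; rewrite leq_eqVlt => /orP[/eqP|]; first by left.
case: k {h1 h2} => [//|k] /=; rewrite !ltnS => vk kv; right.
by apply/eqP; rewrite eqn_leq vk.
Qed.

(** Choose [m] above [D y] and below every [e v y]: a point of [A] within [m] of [y] is too close to
    [y] to lie in any [off v]. This is how intersections of the enlarged sets are traced back to
    [A]. *)
Let common y r (s : seq V) : r <= 1 -> D y < r -> (forall v, v \in s -> 0 < alpha v y) ->
  exists a, [/\ A a, dY y a < r & forall v, v \in s -> O v.2 v.1 (f a)].
Proof.
move=> r1 Dr sP.
have [m [Dm mr ms]] : exists m, [/\ D y < m, m <= r & forall v, v \in s -> m <= e v y].
  elim: s sP => [|v s IH] sP; first by exists r.
  have [|m [Dm mr ms]] := IH; first by move=> w ws; apply: sP; rewrite in_cons ws orbT.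
  have [_ _ De'] := alpha_gt0 (sP _ (mem_head _ _)).
  exists (Num.min m (e v y)); split; rewrite ?lt_min ?Dm ?ge_min ?mr // => w.
  rewrite in_cons => /orP[/eqP->|/ms mw]; rewrite ge_min ?lexx ?orbT // mw //.
have [a Aa ya] := dist1_lt (le_trans mr r1) Dm.
exists a; split=> //; first exact: lt_le_trans ya mr.
move=> v vs; apply: contrapT => nO.
have : e v y <= dY y a by apply: dist1_le.
by have := ms v vs; lra.
Qed.

(** At the index given by [level] both terms of [wt] are positive, and [B k y > 0] provides a vertex
    with [beta > 0]. *)
Let mu_gt0 y : nerve_dom y -> ~ A y -> 0 < mu y.
Proof.
move=> yN nAy; have [k [h1 h2]] := level yN nAy; have D_0 := D_gt0 nAy.
have [||z bz] := @msup_gt _ _ (fun z => beta (z, k) y) 0 => //.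
  by apply: lt_le_trans (psi_B k y); apply: lt_trans h1.
apply: lt_le_trans (mu_ub (z, k) y); rewrite lt_max /wt !lt_min bz andbT.
by apply/orP; right; apply/andP; split; rewrite subr_gt0 //; lra.
Qed.

(** When all weighted indices are within [eta] of [p], [dZ p x] factors out of the supremum [S] up
    to [eta], leaving [mu]. Thus the position approaches [kappa] near [A]. *)
Let xi_near y p x eta : 0 < mu y -> (forall v, 0 < alpha v y -> dZ v.1 p <= eta) ->
  0 <= eta -> `|dZ p x - S y x / mu y| <= eta.
Proof.
move=> m0 near eta0.
have dx v : 0 < alpha v y -> `|dZ v.1 x - dZ p x| <= eta.
  move=> /near h; have := metricD dZm v.1 p x; have := metricD dZm p v.1 x.
  by rewrite (metricC dZm p v.1) ler_norml => ? ?; apply/andP; split; lra.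
have p0 := metric_ge0 dZm p x.
have up : S y x <= (dZ p x + eta) * mu y.
  apply: msup_le => [|v]; first by rewrite mulr_ge0 ?addr_ge0.
  have [->|a0] := alpha_eq0 v y; first by rewrite mul0r mulr_ge0 ?addr_ge0.
  have := dx v a0; rewrite ler_norml => /andP[_ h].
  have := mu_ub v y; have := alpha0 v y => h1 h2.
  apply: (@le_trans _ _ (alpha v y * (dZ p x + eta))); first by rewrite ler_wpM2l //; lra.
  by rewrite mulrC ler_wpM2l // addr_ge0.
have lo : (dZ p x - eta) * mu y <= S y x.
  have [le0|gt0] := lerP (dZ p x - eta) 0.
    by apply: le_trans (S_ge0 y x); rewrite mulr_le0_ge0.
  rewrite -ler_pdivlMl //; apply: msup_le => [|v].
    by rewrite mulr_ge0 // invr_ge0 ltW.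
  rewrite ler_pdivlMl //; apply: le_trans (S_ub v y x).
  have [->|a0] := alpha_eq0 v y; first by rewrite mulr0 mul0r.
  rewrite mulrC ler_wpM2l //.
  by have := dx v a0; rewrite ler_norml => /andP[h _]; lra.
rewrite ler_norml; apply/andP; split.
  by rewrite lerNl opprB lerBlDr ler_pdivrMr // addrC.
by rewrite lerBlDr -lerBlDl ler_pdivlMr.
Qed.

Let nerve_mapA y : A y -> nerve_map y = kappa dZ (f y).
Proof. by move=> Ay; rewrite /nerve_map; case: asboolP. Qed.

Let nerve_mapN y : ~ A y -> nerve_map y =
  fun i => match i with inl x => S y x / mu y | inr v => alpha v y end.
Proof. by move=> Ay; rewrite /nerve_map; case: asboolP. Qed.

Lemma nerve_dom_sub : A `<=` nerve_dom.
Proof. by move=> y Ay; rewrite /nerve_dom /= D_A //; exact: (psi_A 0). Qed.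

Lemma nerve_dom_open y : nerve_dom y -> mnear dY y nerve_dom.
Proof.
move=> yN; exists ((psi 0 y - D y) / 4); first by rewrite divr_gt0 // subr_gt0.
move=> z yz; have := psi_tri 0 y z; have := D_tri z y; have := metric_ge0 dYm y z.
by rewrite (metricC dYm z y) /nerve_dom => ? ? ?; change (D z < psi 0 z); lra.
Qed.

Lemma nerve_map_cont : cont_on dY (@dsup R _) nerve_dom nerve_map.
Proof.
move=> y yN ep ep0.
have [Ay|nAy] := pselect (A y); last first.
  have m0 := mu_gt0 yN nAy.
  (* The weights have Lipschitz constant 4, and the positions satisfy [|s - t| * mu y <= 8 * d];
     either way the change is at most [ep / 2]. *)
  pose c := Num.min (ep / 8) (ep * mu y / 16).
  have c0 : 0 < c by rewrite lt_min !divr_gt0 // mulr_gt0.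
  apply: mnearW (mnearI (Acl I nAy) (mnear_ball dY y c0)) => z [nAz yz] zN.
  have d0 := metric_ge0 dYm y z.
  move: yz; rewrite lt_min => /andP[yz1 yz2].
  have m'0 := mu_gt0 zN nAz.
  apply: (@le_lt_trans _ _ (ep / 2)); last lra.
  rewrite !nerve_mapN //; apply: dsup_le => [|[x|v]]; first lra.
    set s := S y x / mu y; set t := S z x / mu z.
    have sE : S y x = s * mu y by rewrite /s divfK // gt_eqF.
    have tE : S z x = t * mu z by rewrite /t divfK // gt_eqF.
    have t0 : 0 <= t by rewrite divr_ge0.
    have t1 : t <= 1 by rewrite ler_pdivrMr // mul1r.
    have h1 := S_tri y z x; have h2 := S_tri z y x.
    have h3 := mu_tri y z; have h4 := mu_tri z y.
    rewrite (metricC dYm z y) in h2 h4; rewrite sE tE in h1 h2.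
    (* [(s - t) * mu y] is the change of [S] plus [t] times the change of [mu], each at most [4 * d]
       because [0 <= t <= 1]. *)
    have k1 : (s - t) * mu y <= 8 * dY y z by nra.
    have k2 : (t - s) * mu y <= 8 * dY y z by nra.
    rewrite ler_norml; apply/andP; split.
      rewrite lerNl opprB -(ler_pM2r m0); apply: le_trans k2 _; lra.
    rewrite -(ler_pM2r m0); apply: le_trans k1 _; lra.
  have := alpha_tri v y z; have := alpha_tri v z y; rewrite (metricC dYm z y) => ? ?.
  by rewrite ler_norml; apply/andP; split; lra.
have [k0 k0e] : exists k0, 2^-1 ^+ k0 < ep / 4 by apply: half_pow_lt; lra.
have [df df0 dfP] : mnear dY y (fun z => A z -> dZ (f y) (f z) < ep / 4).
  by apply: fc => //; lra.
have p0 := psi_A k0 Ay.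
(* [psi k0 y / 8] excludes levels below [k0], so members have mesh below [ep / 4]; [df / 2] keeps
   the point of [A] chosen near [z] within [df] of [y]; [ep / 8] bounds the weights, which are at
   most [2 * D z]. *)
pose c := Num.min (Num.min 1 (df / 2)) (Num.min (ep / 8) (psi k0 y / 8)).
have c0 : 0 < c by rewrite !lt_min ltr01 !divr_gt0.
exists c => // z; rewrite !lt_min => /andP[/andP[yz1 yz2] /andP[yz3 yz4]] zN.
have Dz : D z <= dY y z by rewrite (metricC dYm); exact: dist1_le.
have [Az|nAz] := pselect (A z).
  rewrite !nerve_mapA //; apply: (@le_lt_trans _ _ (ep / 4)); last lra.
  apply: dsup_le => [|[x|v]]; [lra| |by rewrite /= subrr normr0; lra].
  have yz : dZ (f y) (f z) < ep / 4 by apply: dfP => //; lra.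
  rewrite /= ler_norml.
  have := metricD dZm (f y) (f z) x; have := metricD dZm (f z) (f y) x.
  by rewrite (metricC dZm (f z) (f y)) => ? ?; apply/andP; split; lra.
have m0 := mu_gt0 zN nAz.
have near v : 0 < alpha v z -> dZ v.1 (f y) <= ep / 2.
  move=> a0; have [_ h _] := alpha_gt0 a0.
  have kv : (k0 <= v.2)%N.
    rewrite leqNgt; apply/negP => /(psi_anti z); have := psi_tri k0 y z; lra.
  have r1 : Num.min 1 (df / 2) <= 1 by rewrite ge_min lexx.
  have Dr : D z < Num.min 1 (df / 2).
    by rewrite lt_min; apply/andP; split; apply: le_lt_trans Dz _.
  have [v'|a [Aa za /(_ v (mem_head _ _)) Oa]] := common (s := [:: v]) r1 Dr.
    by rewrite mem_seq1 => /eqP->.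
  move: za; rewrite lt_min => /andP[_ za].
  have fya : dZ (f y) (f a) < ep / 4.
    by apply: dfP => //; have := metricD dYm y z a; lra.
  have := gc_size (gO v.2) Oa.
  have : (2^-1 : R) ^+ v.2 <= 2^-1 ^+ k0.
    by apply: ler_wiXn2l => //; rewrite ?invr_ge0 ?invf_le1 ?ler1n.
  have := metricD dZm v.1 (f a) (f y); rewrite (metricC dZm (f a) (f y)).
  lra.
apply: (@le_lt_trans _ _ (ep / 2)); last lra.
rewrite nerve_mapA // nerve_mapN //; apply: dsup_le => [|[x|v]] /=; first lra.
  by apply: xi_near => //; lra.
rewrite sub0r normrN ger0_norm //; have := alpha_le v z; lra.
Qed.

Let dist_act (P Q : set Y) g y : (forall a, P a -> Q (aY g a)) ->
  dist1 dY Q (aY g y) <= dist1 dY P y.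
Proof.
move=> PQ; apply: dist1_ge => [|a /PQ Qa]; first exact: dist1_le1.
by rewrite -(aYi g); exact: dist1_le.
Qed.

Let dist_actE (P Q : set Y) g y : (forall a, P a -> Q (aY g a)) ->
  (forall a, Q a -> P (aY g^-1%g a)) ->
  dist1 dY Q (aY g y) = dist1 dY P y.
Proof.
move=> PQ QP; apply/eqP; rewrite eq_le dist_act //=.
by rewrite -{1}(actKg aYA g y) dist_act.
Qed.

Let alpha_act g v y : alpha (act_vertex aZ g v) (aY g y) = alpha v y.
Proof.
have DE : D (aY g y) = D y by apply: dist_actE => a; exact: Ainv.
have bE w : beta (act_vertex aZ g w) (aY g y) = beta w y.
  congr (_ - _) => //; apply: dist_actE => a [Aa nO]; split; try exact: Ainv.
    move=> Oa; apply: nO; have := gc_act (gO w.2) g^-1%g Oa.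
    by rewrite /= actKg // fe // actKg.
  by move=> Oa; apply: nO; have := gc_act (gO w.2) g Oa; rewrite /= fe // actKVg.
have BE k : B k (aY g y) = B k y.
  apply: (@msup_reindex _ _ (aZ g) (aZ g^-1%g)) => z; first exact: actKVg.
  by rewrite -bE.
have pE k : psi k (aY g y) = psi k y by elim: k => [|k IH] /=; rewrite BE ?IH.
by rewrite /alpha bE /wt !pE DE.
Qed.

Lemma nerve_dom_inv : invariant_set aY nerve_dom.
Proof.
move=> g y; rewrite /nerve_dom /=.
have -> : D (aY g y) = D y by apply: dist_actE => a; exact: Ainv.
suff -> : B 0 (aY g y) = B 0 y by [].
apply: (@msup_reindex _ _ (aZ g) (aZ g^-1%g)) => z; first exact: actKVg.
congr (_ - _); apply: dist_actE => a; try exact: Ainv; move=> [Aa nO]; split; try exact: Ainv.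
  move=> Oa; apply: nO; have := gc_act (gO 0) g^-1%g Oa.
  by rewrite /= actKg // fe // actKg.
by move=> Oa; apply: nO; have := gc_act (gO 0) g Oa; rewrite /= fe // actKVg.
Qed.

Lemma nerve_map_equiv : equivariant_on aY (act_coords aZ) nerve_dom nerve_map.
Proof.
move=> g y _; have [Ay|nAy] := pselect (A y).
  by rewrite !nerve_mapA ?fe //; [rewrite kappa_act | exact: Ainv].
have nAg : ~ A (aY g y) by move=> /(Ainv g^-1%g); rewrite actKg.
have vV := act_vertex_laws aZA.
rewrite !nerve_mapN //; apply/funext => -[x|v]; rewrite /act_coords /=; last first.
  by rewrite -[in LHS](actKVg vV g v) alpha_act.
congr (_ / _).
  apply: (@msup_reindex _ _ (act_vertex aZ g) (act_vertex aZ g^-1%g)) => v.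
    exact: (actKVg vV).
  by rewrite alpha_act /= -(aZi g _ (aZ g^-1%g x)) actKVg.
apply: (@msup_reindex _ _ (act_vertex aZ g) (act_vertex aZ g^-1%g)) => v.
  exact: (actKVg vV).
by rewrite alpha_act.
Qed.

Let kappa_skeleton n z : skeleton dZ aZ O n (kappa dZ z).
Proof. by elim: n => [|n IH]; [exists z | left]. Qed.

Let cell_skeleton n m u : (0 < n <= m)%N -> open_cell aZ O n u -> skeleton dZ aZ O m u.
Proof.
elim: m => [|m IH]; first by case: n.
move=> /andP[n0]; rewrite leq_eqVlt => /orP[/eqP-> |nm nu]; first by right.
by left; apply: IH => //; rewrite n0.
Qed.

(** Only two consecutive levels carry weight, and on each at most [M] members contain the common
    point [f a]; hence [M + M]. *)
Lemma nerve_map_skeleton y : nerve_dom y -> skeleton dZ aZ O (M + M) (nerve_map y).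
Proof.
move=> yN; have [Ay|nAy] := pselect (A y); first by rewrite nerve_mapA.
have m0 := mu_gt0 yN nAy; have [k [kD Dk]] := level yN nAy.
have Dlt1 : D y < 1.
  apply: lt_le_trans yN _; exact: B1.
have [s us sP|l [ul sl lP]] := @bounded_enum _ (fun v => 0 < alpha v y) (M + M).
  have [a [Aa _ aP]] := common (lexx 1) Dlt1 sP.
  have [l1 sl1 l1P] := gc_order (gO k) (f a).
  have [l2 sl2 l2P] := gc_order (gO k.-1) (f a).
  pose t : seq V := map (fun z => (z, k)) l1 ++ map (fun z => (z, k.-1)) l2.
  apply: (@leq_trans (size t)); last by rewrite size_cat !size_map leq_add.
  apply: uniq_leq_size => // -[z j] vs; have Oz := aP _ vs.
  rewrite mem_cat; apply/orP; case: (level_uniq Dk kD (sP _ vs)) => /= jE; subst j.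
    by left; apply: map_f; exact: l1P.
  by right; apply: map_f; exact: l2P.
have suppE v : supp (nerve_map y) v <-> v \in l.
  rewrite -lP /supp /= nerve_mapN //.
  by split => [|/gt_eqF/eqP//]; have [->|] := alpha_eq0 v y.
apply: (@cell_skeleton (size l)).
  rewrite sl andbT lt0n; apply/negP => /eqP/size0nil l0.
  have [||v] := @msup_gt _ _ (alpha^~ y) 0 => //.
  by move=> /lP; rewrite l0.
split; first by exists l.
  have [v /lP//|a [_ _ aP]] := common (s := l) (lexx 1) Dlt1.
  by exists (f a) => v /suppE/aP.
have vV := act_vertex_laws aZA.
(* The position is computed from the weighted vertices alone, so an element fixing all of them fixes
   the position. *)
move=> g gP; have gP' v : 0 < alpha v y -> act_vertex aZ g v = v.
  by move=> /lP/suppE; exact: gP.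
have gV v : 0 < alpha v y -> act_vertex aZ g^-1%g v = v.
  by move=> /gP'{1}<-; rewrite (actKg vV).
rewrite nerve_mapN //; apply/funext => -[x|v]; rewrite /act_coords /=.
  congr (_ / _); congr msup; apply/funext => v.
  have [->|a0] := alpha_eq0 v y; first by rewrite !mul0r.
  congr (_ * _); rewrite -(aZi g) actKVg //.
  by have /(congr1 fst) /= -> := gP' v a0.
have [a0|a0] := alpha_eq0 v y; last by rewrite gV.
have [->|a1] := alpha_eq0 (act_vertex aZ g^-1%g v) y; first by rewrite a0.
by have := gP' _ a1; rewrite (actKVg vV) => <-.
Qed.

Hypothesis extZ : forall H : {group gT}, ext_property dZ (fixset aZ H).

Lemma equivariant_extension (z0 : Z) : exists (U : set Y) (F : Y -> Z),
  [/\ nbhd_in dY setT A U, invariant_set aY U, cont_on dY dZ U F, equivariant_on aY aZ U F &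
      forall a, A a -> F a = f a].
Proof.
have [U [r [US [kU Ui] Un rc [re rk]]]] :=
  skeleton_retraction dZm aZA aZi gO extZ z0 (M + M).
exists (nerve_dom `&` nerve_map @^-1` U), (r \o nerve_map); split.
- move=> a Aa; have aN := nerve_dom_sub Aa.
  have [e' e'0 eU] : mnear (@dsup R _) (nerve_map a) (fun u => skeleton dZ aZ O (M + M) u -> U u).
    by apply: Un; rewrite nerve_mapA //; exists (f a).
  apply: mnearW (mnearI (nerve_dom_open aN) (nerve_map_cont aN e'0)) => y [yN yU] _.
  by split => //; apply: eU; [exact: yU | exact: nerve_map_skeleton].
- move=> g y [yN yU]; split; first exact: nerve_dom_inv.
  by rewrite /preimage /= nerve_map_equiv //; exact: Ui.
- move=> y [yN yU] ep ep0; have [c c0 cP] := rc _ yU _ ep0.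
  apply: mnearW (nerve_map_cont yN c0) => z h [zN zU] /=.
  by apply: cP => //; exact: h.
- by move=> g y [yN yU] /=; rewrite nerve_map_equiv // re.
- by move=> a Aa /=; rewrite nerve_mapA.
Qed.

End NerveMap.

(** * Refinements of bounded order *)

Lemma size_flatten_le (I T : Type) (F : I -> seq T) (s : seq I) n :
  (forall i, size (F i) <= n)%N -> (size (flatten (map F s)) <= size s * n)%N.
Proof.
by move=> Fn; elim: s => //= i s IH; rewrite size_cat mulSn leq_add.
Qed.

Section Covers.
Variable R : realType.

Definition mopen (T : Type) (d : T -> T -> R) (U : set T) : Prop :=
  forall x, U x -> mnear d x U.

(** Every open cover has an open refinement of order at most [N]; the cover is presented by a
    neighborhood [B x] of each point. *)
Definition refinable (T : Type) (d : T -> T -> R) (N : nat) : Prop :=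
  forall B : T -> set T, (forall x, mnear d x (B x)) ->
  exists (I : eqType) (V : I -> set T),
    [/\ forall i, mopen d (V i), forall x, exists i, V i x,
        forall i, (exists x, V i x) -> exists z, V i `<=` B z &
        forall x, exists2 l : seq I, (size l <= N)%N & forall i, V i x -> i \in l].

Definition finite_cover_dim (T : Type) (d : T -> T -> R) (n : nat) : Prop :=
  forall (k : nat) (U : 'I_k -> set T),
    (forall i, mopen d (U i)) -> (forall x, exists i, U i x) ->
    exists (m : nat) (V : 'I_m -> set T),
      [/\ forall j, mopen d (V j),
          forall x, exists j, V j x,
          forall j, exists i, V j `<=` U i &
          forall (x : T) (J : {set 'I_m}),
            (forall j, j \in J -> V j x) -> (#|J| <= n.+1)%N].

(** * Invariant good covers from refinements of bounded order *)

Section GoodCover.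
Variables (gT : finGroupType) (Z : choiceType) (d : Z -> Z -> R) (a : gT -> Z -> Z).
Hypotheses (dm : is_metric d) (aA : act_laws a) (ai : isometric d a).

(** All translates of the members of a refinement are taken, indexed by the translates of chosen
    centers [zeta i]; members with the same index are merged. A point has [#|gT|] translates, each
    in at most [N] members. *)
Lemma good_cover_exists (z0 : Z) N eps : refinable d N -> 0 < eps ->
  exists O, good_cover d a O eps (#|gT| * N).
Proof.
move=> rN eps0.
(* The second condition keeps [w] closer to [z] than half the distance from [z] to any of its other
   translates. *)
pose B z := [set w | d z w < eps /\ forall h, a h z <> z -> 2 * d z w < d (a h z) z].
have Bn z : mnear d z (B z).
  apply: mnearI; first exact: mnear_ball.
  apply: mnear_fin => h; have [e|ne] := pselect (a h z = z); first by apply: mnearT.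
  exists (d (a h z) z / 2); first by rewrite divr_gt0 // (metric_gt0 dm).
  by move=> w zw _; lra.
have [I [V [Vo Vc VB Vl]]] := rN B Bn.
have /choice[zeta zetaP] : forall i, exists z, V i `<=` B z.
  move=> i; have [/VB//|nV] := pselect (exists x, V i x).
  by exists z0 => w Vw; exfalso; apply: nV; exists w.
pose O z := [set w | exists g i, V i (a g^-1%g w) /\ z = a g (zeta i)].
have OB z w : O z w -> B z w.
  move=> [g [i [/zetaP[h1 h2] ->]]].
  have E : d (a g (zeta i)) w = d (zeta i) (a g^-1%g w).
    by rewrite -[in RHS](ai g) actKVg.
  split; rewrite E // => h hz.
  have := h2 (g^-1 * h * g)%g; rewrite -!act_mul // -(ai g (a g^-1%g _)) actKVg //.
  by apply => hz'; apply: hz; rewrite -[LHS](actKVg aA g) hz'.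
exists O; split.
- move=> z w [g [i [Vw zE]]].
  apply: mnearW (mnear_act ai (Vo _ _ Vw)) => y Vy.
  by exists g, i.
- move=> w; have [i Vw] := Vc w; exists (zeta i), 1%g, i.
  by rewrite invg1 !act_one.
- move=> h z w [g [i [Vw ->]]]; exists (h * g)%g, i.
  by split; [rewrite invMg -act_mul // actKg | rewrite act_mul].
(* Otherwise [w] is closer than half of [d z (a g z)] to both [z] and [a g z], against the triangle
   inequality. *)
- move=> g z w /OB[_ h1] /OB[_ h2]; apply: contrapT => gz.
  have := h1 g gz; have := h2 g^-1%g; rewrite actKg // => /(_ (fun e => gz (esym e))).
  have := metricD dm z w (a g z).
  by rewrite (metricC dm w) (metricC dm (a g z) z); lra.
- by move=> z w /OB[].
- move=> w.
  have /choice[l lP] : forall g, exists l : seq I, (size l <= N)%N /\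
      forall i, V i (a g^-1%g w) -> i \in l.
    by move=> g; have [l ls lP] := Vl (a g^-1%g w); exists l.
  exists (flatten (map (fun g => map (fun i => a g (zeta i)) (l g)) (enum gT))).
    rewrite cardE; apply: size_flatten_le => g; rewrite size_map.
    by have [] := lP g.
  move=> z [g [i [Vw ->]]]; apply/flattenP.
  exists (map (fun i => a g (zeta i)) (l g)).
    by apply/mapP; exists g; rewrite ?mem_enum.
  by apply/mapP; exists i => //; have [_] := lP g; apply.
Qed.

End GoodCover.

(** Each piece is refined separately and the families are put together; a point has at most one
    preimage in each piece. *)
Lemma refinable_pieces (G : finType) (X Z : Type) (dX : X -> X -> R)
    (dZ : Z -> Z -> R) (q : G -> X -> Z) N :
  (forall z, exists g x, q g x = z) ->
  (forall g, injective (q g)) ->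
  (forall g x P, mnear dX x P -> mnear dZ (q g x) (fun w => exists2 y, P y & q g y = w)) ->
  (forall g x P, mnear dZ (q g x) P -> mnear dX x (fun y => P (q g y))) ->
  refinable dX N -> refinable dZ (#|G| * N).
Proof.
move=> qs qi qo qc rN B Bn.
have ex g : exists p : {I : eqType & I -> set X},
    [/\ forall i, mopen dX (projT2 p i), forall x, exists i, projT2 p i x,
        forall i, (exists x, projT2 p i x) ->
          exists z, projT2 p i `<=` [set y | B (q g z) (q g y)] &
        forall x, exists2 l : seq (projT1 p), (size l <= N)%N &
          forall i, projT2 p i x -> i \in l].
  have [|I [V VP]] := rN (fun x => [set y | B (q g x) (q g y)]).
    by move=> x; apply: qc.
  by exists (existT _ I V).
have {ex} [p pP] := choice ex.
exists {g : G & projT1 (p g)}, (fun i => q (tag i) @` projT2 (p (tag i)) (tagged i)); split.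
- move=> [g i] _ [x Vx <-] /=; have [Vo _ _ _] := pP g.
  by apply: mnearW (qo g _ _ (Vo i x Vx)) => w [y Vy <-]; exists y.
- move=> z; have [g [x <-]] := qs z; have [_ Vc _ _] := pP g.
  by have [i Vx] := Vc x; exists (existT _ g i); exists x.
- move=> [g i] [_ [x Vx _]] /=; have [_ _ VB _] := pP g.
  have [|z zP] := VB i; first by exists x.
  by exists (q g z) => _ [y Vy <-]; exact: zP.
- move=> w.
  have ex g : exists l : seq (projT1 (p g)), (size l <= N)%N /\
      forall x, q g x = w -> forall i, projT2 (p g) i x -> i \in l.
    have [[x xw]|nx] := pselect (exists x, q g x = w); last first.
      by exists [::]; split => // x xw; exfalso; apply: nx; exists x.
    have [_ _ _ Vl] := pP g; have [l ls lP] := Vl x; exists l; split => // y yw.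
    by have -> : y = x by apply: (qi g); rewrite yw xw.
  pose l g := sval (cid (ex g)).
  have lP g : (size (l g) <= N)%N /\
      forall x, q g x = w -> forall i, projT2 (p g) i x -> i \in l g
    by rewrite /l; case: cid.
  exists (flatten (map (fun g => map (existT (fun g => projT1 (p g) : Type) g) (l g)) (enum G))).
    rewrite cardE; apply: size_flatten_le => g; rewrite size_map.
    by have [] := lP g.
  move=> [g i] [x Vx xw]; apply/flattenP.
  exists (map (existT (fun g => projT1 (p g) : Type) g) (l g)).
    by apply/mapP; exists g; rewrite ?mem_enum.
  by apply: map_f; have [_ h] := lP g; exact: (h x).
Qed.

(** * Separable metric spaces of finite covering dimension *)

Section SeparableCover.
Variables (T : Type) (d : T -> T -> R).
Hypothesis dm : is_metric d.

Lemma countable_subcover (s : nat -> T) (B : T -> set T) :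
  (forall x e, 0 < e -> exists n, d x (s n) < e) -> (forall x, mnear d x (B x)) ->
  exists U : nat -> set T, [/\ forall p, mopen d (U p), forall x, exists p, U p x &
    forall p, exists z, U p `<=` B z].
Proof.
move=> sd Bn.
pose ball p := if @unpickle (nat * nat)%type p is Some (n, q)
  then [set y | d (s n) y < 2^-1 ^+ q] else set0.
(* Balls of radius [2^-q] around the dense sequence, replaced by the empty set unless contained in
   some [B z]. *)
pose U p := [set y | ball p y /\ exists z, ball p `<=` B z].
exists U; split.
- move=> p y [by_ zB].
  suff : mnear d y (ball p) by apply: mnearW => z bz.
  move: by_; rewrite /ball; case: unpickle => [[n q] /= yn|//].
  exists (2^-1 ^+ q - d (s n) y); first by rewrite subr_gt0.
  by move=> z yz; have := metricD dm (s n) y z; rewrite /=; lra.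
- move=> x; have [e e0 eB] := Bn x.
  have e20 : 0 < e / 2 by lra.
  have [q qe] := half_pow_lt e20.
  have q0 : 0 < (2^-1 : R) ^+ q by rewrite exprn_gt0 // invr_gt0.
  have [n xn] := sd x _ q0.
  exists (pickle (n, q)); rewrite /U /ball pickleK /=; split.
    by rewrite (metricC dm).
  by exists x => y /= yn; apply: eB; have := metricD dm x (s n) y; lra.
- move=> p; have [[z pz]|np] := pselect (exists z, ball p `<=` B z).
    by exists z => y [/pz].
  by exists (s 0%N) => y [_ /np].
Qed.

(* The sets [G m] exhaust the space with [closure (G m)] inside [G m.+1]; each
   annulus between [G m] and [G m.+2] is covered by finitely many of the [U p]. *)
Lemma refinable_separable (s : nat -> T) n :
  (forall x e, 0 < e -> exists n, d x (s n) < e) ->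
  finite_cover_dim d n -> refinable d (n.+1 + n.+1).
Proof.
move=> sd dn B Bn; have [U [Uo Uc UB]] := countable_subcover sd Bn.
(* Points around which some [U i] with [i <= m - 2] contains a ball of radius above [2^-m]; [G 0]
   and [G 1] are empty. *)
pose G m : set T := [set x | exists i, (i.+2 <= m)%N /\
  exists2 r, 2^-1 ^+ m < r & forall y, d x y < r -> U i y].
have half m : (2^-1 : R) ^+ m = 2^-1 ^+ m.+1 + 2^-1 ^+ m.+1.
  by rewrite exprS; lra.
have pos m : 0 < (2^-1 : R) ^+ m by rewrite exprn_gt0 // invr_gt0.
have Gshrink x y m c : G m y -> 0 <= c -> d x y < 2^-1 ^+ m - c -> exists i,
    (i.+2 <= m)%N /\ exists2 r, c < r & forall z, d x z < r -> U i z.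
  move=> [i [im [r mr rU]]] c0 xy; exists i; split=> //; exists (r - d x y); first lra.
  by move=> z xz; apply: rU; have := metricD dm y x z; rewrite (metricC dm y x); lra.
have G_open m : mopen d (G m).
  move=> x [i [im [r mr rU]]]; exists (r - 2^-1 ^+ m); first lra.
  move=> y xy; exists i; split=> //; exists (r - d x y); first lra.
  by move=> z yz; apply: rU; have := metricD dm x y z; lra.
have GS m x : G m x -> G m.+1 x.
  move=> [i [im [r mr rU]]]; exists i; split; first exact: leqW.
  by exists r => //; have := half m; have := pos m.+1; lra.
have Gmono m k x : (m <= k)%N -> G m x -> G k x.
  elim: k => [|k IH]; first by rewrite leqn0 => /eqP->.
  by rewrite leq_eqVlt => /orP[/eqP->//|/IH h /h /GS].
have GU m x : G m x -> exists2 i, (i.+2 <= m)%N & U i x.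
  move=> [i [im [r mr rU]]]; exists i => //; apply: rU.
  by rewrite (metricxx dm); have := pos m; lra.
have Gcov x : exists m, G m x.
  have [i Ux] := Uc x; have [r r0 rU] := Uo i x Ux.
  have [m mr] := half_pow_lt r0; exists (maxn m i.+2), i; split; first exact: leq_maxr.
  exists r => //; apply: le_lt_trans mr; apply: ler_wiXn2l;
    by rewrite ?leq_maxl ?invr_ge0 ?invf_le1 ?ler1n ?ltr0n.
pose Q m : set T := [set x | mnear d x (fun y => ~ G m y)].
have Q_open m : mopen d (Q m) by move=> x; exact: mnear_mnear.
have QG m x : ~ Q m x -> G m.+1 x.
  move=> nQ; apply: contrapT => nG; apply: nQ; exists (2^-1 ^+ m.+1) => // y xy Gy.
  apply: nG; have [||i [im [r rr rU]]] := Gshrink x y m (2^-1 ^+ m.+1) Gy; first exact: ltW.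
    by have := half m; lra.
  by exists i; split; [exact: leqW | exists r].
have Q_G m x : Q m x -> ~ G m x by move=> /(mnear_self dm).
(* A finite cover of the whole space: the last member is the exterior of [G k.+2], and its
   complement lies in [G k.+3], covered by the [U i] with [i < k.+2]. Being disjoint from [G k.+2],
   the last member contributes nothing on annulus [k]. *)
pose W k (i : 'I_k.+3) : set T := if (i < k.+2)%N then U i else Q k.+2.
have ex k : exists p : {m : nat & 'I_m -> set T},
    [/\ forall j, mopen d (projT2 p j),
          forall x, exists j, projT2 p j x,
          forall j, exists i, projT2 p j `<=` W k i &
          forall (x : T) (J : {set 'I_(projT1 p)}),
            (forall j, j \in J -> projT2 p j x) -> (#|J| <= n.+1)%N].
  have [||m [V VP]] := dn k.+3 (W k).
  - by move=> i; rewrite /W; case: ifP => _.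
  - move=> x; have [Qx|/QG/GU[i ik Ux]] := pselect (Q k.+2 x).
      by exists ord_max; rewrite /W ltnn.
    have i3 : (i < k.+3)%N by rewrite (leq_trans _ (leqnSn _)) // -ltnS ltnW.
    by exists (Ordinal i3); rewrite /W /= -ltnS ik.
  by exists (existT _ m V).
have {ex} [p pP] := choice ex.
exists {k : nat & 'I_(projT1 (p k))},
  (fun i => projT2 (p (tag i)) (tagged i) `&` (G (tag i).+2 `&` Q (tag i))); split.
- move=> [k j] x [Vx [Gx Qx]] /=; have [Vo _ _ _] := pP k.
  by apply: mnearI; [exact: Vo | apply: mnearI; [exact: G_open | exact: Q_open]].
- move=> x; have [m Gm mm] : exists2 m, G m x & forall k, G k x -> (m <= k)%N.
    have ex : exists m, `[< G m x >] by have [m Gm] := Gcov x; exists m; apply/asboolP.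
    case: (ex_minnP ex) => m /asboolP Gm mm; exists m => // k Gk.
    by apply: mm; apply/asboolP.
  have [i im _] := GU _ _ Gm.
  (* The first [m] with [G m x] is at least 2; writing it [k.+2], [x] lies in annulus [k], since
     outside [Q k] it would lie in [G k.+1]. *)
  case: m Gm mm im => [//|[//|k]] Gk km _.
  have [_ Vc _ _] := pP k; have [j Vj] := Vc x.
  exists (existT _ k j); split => //; split => //; apply: contrapT => /QG /km.
  by rewrite ltnn.
- move=> [k j] [x [/= Vx [Gx _]]]; have [_ _ VW _] := pP k.
  have [i VWi] := VW j; have := VWi x Vx; rewrite /W.
  case: ifP => [ik _|_ /Q_G//]; have [z Uz] := UB i; exists z => y [/VWi + _].
  by rewrite /W ik => /Uz.
- move=> x.
  have [m Gm mm] : exists2 m, G m x & forall k, G k x -> (m <= k)%N.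
    have ex : exists m, `[< G m x >] by have [m Gm] := Gcov x; exists m; apply/asboolP.
    case: (ex_minnP ex) => m /asboolP Gm mm; exists m => // k Gk.
    by apply: mm; apply/asboolP.
  pose J k := [set j : 'I_(projT1 (p k)) | `[< projT2 (p k) j x >]]%SET.
  have sJ k : (size (enum (J k)) <= n.+1)%N.
    rewrite -cardE; have [_ _ _ h] := pP k; apply: (h x) => j.
    by rewrite inE => /asboolP.
  pose l k := map (existT (fun k => 'I_(projT1 (p k)) : Type) k) (enum (J k)).
  (* Annulus [k] contains [x] only if [k < m <= k.+2]. *)
  exists (l m.-1 ++ l m.-2); first by rewrite size_cat !size_map leq_add ?sJ.
  move=> [k j] [/= Vx [Gx Qx]].
  have km : (k < m)%N.
    rewrite ltnNge; apply/negP => mk; apply: (Q_G _ _ Qx); exact: Gmono Gm.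
  have mk := mm _ Gx.
  have jl : existT _ k j \in l k.
    by apply: map_f; rewrite mem_enum inE; apply/asboolP.
  rewrite mem_cat; have [->|->] : m = k.+1 \/ m = k.+2.
  + by move: km mk; rewrite leq_eqVlt => /orP[/eqP|h1 h2]; [left | right; apply/eqP; rewrite eqn_leq h2].
  + by rewrite jl.
  + by rewrite jl orbT.
Qed.

End SeparableCover.
End Covers.

(** * Metric and topological notions *)

Section MetricSpace.
Variables (R : realType) (T : Type) (d : T -> T -> R).

(** An alias carrying the topology of [d], to feed bare metric types to [ANE]. *)
Definition metric_space (dm : is_metric d) : Type := T.

Variable dm : is_metric d.

HB.instance Definition _ := gen_eqMixin (metric_space dm).
HB.instance Definition _ := gen_choiceMixin (metric_space dm).

Let dpos (x y : metric_space dm) : d x y = 0 -> x = y.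
Proof. by move/(metric_eq0 dm). Qed.

HB.instance Definition _ := @isMetric.Build R (metric_space dm) d
  (metricxx dm) dpos (metricC dm) (fun y x z => metricD dm x y z).

End MetricSpace.

Section Compatible.
Variable R : realType.

Definition compatible (T : topologicalType) (d : T -> T -> R) : Prop :=
  is_metric d /\ forall (x : T) (A : set T), nbhs x A <-> mnear d x A.

Lemma metrizableP (T : topologicalType) :
  metrizable R T <-> exists d : T -> T -> R, compatible d.
Proof.
split=> [[d [d0 dC dD dn]]|[d [[d0 dC dD] dn]]]; exists d; last by split.
by split=> //; split.
Qed.

Lemma metric_space_compatible (T : Type) (d : T -> T -> R) (dm : is_metric d) :
  compatible (T := metric_space dm) d.
Proof.
split=> // x A; split=> [/nbhs_ballP[e e0 eA]|[e e0 eA]].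
  exists e => // y xy; apply: eA; rewrite ballEmdist; exact: xy.
by apply/nbhs_ballP; exists e => // y; rewrite ballEmdist; exact: eA.
Qed.

Lemma mopen_open (T : topologicalType) (d : T -> T -> R) (U : set T) :
  compatible d -> open U <-> mopen d U.
Proof.
move=> [_ dn]; rewrite openE; split=> h x Ux; first exact/dn/h.
exact/dn/h.
Qed.

Lemma closed_closed_in (T : topologicalType) (d : T -> T -> R) (C : set T) :
  compatible d -> closed C -> closed_in d setT C.
Proof.
move=> dc; rewrite -openC => /(mopen_open _ dc) h x _; exact: h.
Qed.

Lemma closed_in_closed (T : topologicalType) (d : T -> T -> R) (C : set T) :
  compatible d -> closed_in d setT C -> closed C.
Proof. by move=> dc h; rewrite -openC; apply/(mopen_open _ dc) => x; exact: h. Qed.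

Lemma within_contP (S T : topologicalType) (dS : S -> S -> R) (dT : T -> T -> R)
    (A : set S) (f : S -> T) : compatible dS -> compatible dT ->
  {within A, continuous f} <-> cont_on dS dT A f.
Proof.
move=> [dSm dSn] [dTm dTn]; split=> [/subspace_continuousP fc x Ax e e0|fc].
  by apply/dSn; apply: (fc x Ax [set y | dT (f x) y < e]); apply/dTn; exists e.
apply/subspace_continuousP => x Ax P /dTn[e e0 eP]; apply/dSn.
by apply: mnearW (fc x Ax e e0) => y h Ay; apply: eP; exact: h.
Qed.

Lemma set_type_compatible (T : topologicalType) (d : T -> T -> R) (S : set T) :
  compatible d -> compatible (T := set_type S) (fun x y => d (val x) (val y)).
Proof.
move=> [dm dn]; split.
  split=> [x y|x y|x y z]; [|exact: (metricC dm)|exact: (metricD dm)].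
  by split=> [/(metric_eq0 dm)/val_inj|->]; last exact/(metric_eq0 dm).
move=> x A; split=> [|[e e0 eA]].
  rewrite nbhsE => -[B [[B' oB' <-] B'x] BA].
  have [e e0 eB] := (mopen_open B' (conj dm dn)).1 oB' _ B'x.
  by exists e => // y xy; apply: BA; exact: eB.
have nx : nbhs (val x) [set y | d (val x) y < e] by apply/dn; exists e.
have h : nbhs x (val @^-1` [set y | d (val x) y < e]).
  exact: (@initial_continuous (set_type S) T set_val x _ nx).
by apply: filterS h => y; exact: eA.
Qed.

(** [B] is made a metric space in its own right and [f] is corestricted to the subtype [S]; values
    outside the relevant sets are filled in arbitrarily. *)
Lemma ANE_ext_property (X : topologicalType) (dX : X -> X -> R) (S : set X) :
  compatible dX -> ANE R S -> ext_property dX S.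
Proof.
move=> dXc [_ SE] Y dY dYm B C CB Ccl f fc fS.
(* For [C] empty the empty neighborhood serves; otherwise a point of [C] provides a default value in
   [S]. *)
have [[c Cc]|nC] := pselect (exists c, C c); last first.
  exists set0, f; split=> // [c Cc|c Cc]; exfalso; apply: nC; by exists c.
pose Y' := {y | B y}; pose d' (x y : Y') := dY (sval x) (sval y).
have d'm : is_metric d'.
  split=> [x y|x y|x y z]; [|exact: (metricC dYm)|exact: (metricD dYm)].
  split=> [/(metric_eq0 dYm)|->]; last exact/(metric_eq0 dYm).
  exact: eq_sig_hprop (fun _ _ _ => Prop_irrelevance _ _) _ _.
have Y'c := metric_space_compatible d'm.
pose C' : set (metric_space d'm) := [set y | C (sval y)].
pose s0 : S := SigSub (mem_set (fS c Cc)).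
pose f' (y : metric_space d'm) : S :=
  if pselect (C (sval y)) is left Cy then SigSub (mem_set (fS _ Cy)) else s0.
have f'E y : C' y -> val (f' y) = f (sval y).
  by move=> Cy; rewrite /f'; case: pselect.
have Sc := set_type_compatible S dXc.
have C'cl : closed C'.
  apply: (closed_in_closed Y'c) => y _ nCy.
  have [e e0 eC] := Ccl (sval y) (svalP y) nCy.
  by exists e => // z; exact: eC.
have f'c : {within C', continuous f'}.
  apply/(within_contP _ _ Y'c Sc) => y Cy e e0.
  have [r r0 rP] := fc _ Cy e e0; exists r => // z yz Cz.
  by rewrite !f'E //; exact: rP.
have mY' : metrizable R (metric_space d'm) by apply/metrizableP; exists d'.
have [U [F [CU /(within_contP _ _ Y'c Sc) Fc FE]]] := SE _ mY' _ C'cl _ f'c.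
have {}FE y : C' y -> F y = f' y by move=> Cy; apply: FE; rewrite inE.
pose G y := if pselect (B y) is left By then val (F (exist _ y By)) else f y.
have GE y (By : B y) : G y = val (F (exist _ y By)).
  by rewrite /G; case: pselect => // By'; rewrite (Prop_irrelevance By' By).
exists [set y | exists By : B y, U (exist _ y By)], G; split.
- by move=> y [].
- move=> y Cy; exists (CB _ Cy).
  exact: (@nbhs_singleton _ (exist _ y (CB _ Cy) : metric_space d'm) U (CU (exist _ y (CB _ Cy)) Cy)).
- move=> y Cy; have /(Y'c.2)[e e0 eU] := CU (exist _ y (CB _ Cy)) Cy.
  by exists e => // z yz Bz; exists Bz; exact: eU.
- move=> y [By Uy] e e0; have [r r0 rP] := Fc _ Uy e e0.
  exists r => // z yz [Bz Uz]; rewrite !GE; exact: rP.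
- split=> [y [By Uy]|y Cy]; first by rewrite GE; exact/set_mem/(valP (F _)).
  by rewrite (GE _ (CB _ Cy)) FE // f'E.
Qed.

End Compatible.

(** * The enveloping space *)

Section DiscreteProduct.
Variables (gT : finGroupType) (X : topologicalType).

Lemma nbhs_discr_prod (g : discrete_topology gT) (x : X) (P : set (discr_prod gT X)) :
  nbhs (g, x) P <-> nbhs x [set y | P (g, y)].
Proof.
split=> [[[A B] [/= nA nB] AB]|nP].
  by apply: filterS nB => y By; apply: AB; split => //=; exact: nbhs_singleton nA.
exists ([set g], [set y | P (g, y)]); first by split.
by move=> [h y] [/= -> ].
Qed.

Lemma open_discr_prod (U : set (discr_prod gT X)) :
  open U <-> forall g, open [set x | U (g, x)].
Proof.
rewrite openE; split=> [h g|h [g x] Ux].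
  by rewrite openE => x Ux; apply/nbhs_discr_prod; exact: h.
by apply/nbhs_discr_prod; move: (h g); rewrite openE; apply.
Qed.

End DiscreteProduct.

(** * Invariant metrics for actions of a finite group *)

Section InvariantMetric.
Variables (R : realType) (gT : finGroupType).

(** The supremum of the translates of a metric truncated at 1; it induces the same topology because
    finitely many continuous maps are involved. *)
Lemma invariant_metric (Y : topologicalType) (a : gT -> Y -> Y) :
  metrizable R Y -> continuous_global_action a ->
  exists d : Y -> Y -> R, [/\ compatible d, act_laws a & isometric d a].
Proof.
move=> /metrizableP[d0 d0c] [a1 aM ac].
have [d0m d0n] := d0c.
have aA : act_laws a by split.
pose d x y := msup (fun g => Num.min 1 (d0 (a g x) (a g y))).
have le1 x y g : Num.min 1 (d0 (a g x) (a g y)) <= 1 by rewrite ge_min lexx.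
have d_lt x y g e : e <= 1 -> d x y < e -> d0 (a g x) (a g y) < e.
  move=> e1 xy; have := le_lt_trans (msup_ub g (le1 x y)) xy.
  by rewrite gt_min ltNge e1.
have d_le x y c : 0 <= c -> (forall g, d0 (a g x) (a g y) <= c) -> d x y <= c.
  by move=> c0 h; apply: msup_le => // g; rewrite ge_min h orbT.
have dm : is_metric d.
  split.
  - move=> x y; split=> [xy|->]; last first.
      apply/eqP; rewrite eq_le msup_ge0 // andbT.
      by apply: d_le => // g; rewrite (metricxx d0m).
    apply: contrapT => nxy; have p := metric_gt0 d0m nxy.
    have : Num.min 1 (d0 x y) <= 0.
      by rewrite -xy; have := msup_ub 1%g (le1 x y); rewrite !a1.
    by rewrite ge_min leNgt ltr01 leNgt p.
  - by move=> x y; congr msup; apply/funext => g; rewrite (metricC d0m).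
  - move=> x y z; apply: msup_le => [|g]; first by rewrite addr_ge0 // msup_ge0.
    have h1 := msup_ub g (le1 x y); have h2 := msup_ub g (le1 y z).
    apply: le_trans (lerD h1 h2).
    have := metricD d0m (a g x) (a g y) (a g z).
    have := metric_ge0 d0m (a g x) (a g y); have := metric_ge0 d0m (a g y) (a g z).
    rewrite /Num.min; do 3 (case: ltP => ?); lra.
exists d; split=> //; last first.
  move=> g x y; apply: (@msup_reindex _ _ (fun h => h * g^-1)%g (fun h => h * g)%g) => h.
    by rewrite mulgK.
  by rewrite !aM mulgKV.
split=> // x A; split=> [/d0n[e e0 eA]|[e e0 eA]]; last first.
  have : mnear d0 x (fun y => forall g, d0 (a g x) (a g y) < e / 2).
    apply: mnear_fin => g; apply/d0n.
    have nb : nbhs (a g x) [set z | d0 (a g x) z < e / 2].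
      by apply/d0n; exists (e / 2) => //; lra.
    exact: (nbhs_discr_prod g x _).1 (ac (g, x) _ nb).
  move=> h; apply/d0n; apply: mnearW h => y h; apply: eA.
  apply: (@le_lt_trans _ _ (e / 2)); last lra.
  by apply: d_le => [|g]; [lra | exact: ltW].
exists (Num.min e 1); first by rewrite lt_min e0 ltr01.
move=> y /(d_lt x y 1%g); rewrite ge_min lexx orbT !a1 => /(_ isT).
by rewrite lt_min => /andP[/eA].
Qed.

End InvariantMetric.

Section Envelope.
Variables (R : realType) (gT : finGroupType) (X : topologicalType).
Variables (theta : partial_action gT X) (dX : X -> X -> R).
Hypothesis dXc : compatible dX.
Hypotheses (theta_top : topological_pa theta) (theta_cl : closed (pa_graph theta)).

Local Notation Z := (env_space theta).
Let dom (k : gT) : set X := [set x | pa_dom theta (k, x)].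

Definition env_pt (g : gT) (x : X) : Z := env_class theta (g, x).

Let dXm : is_metric dX := dXc.1.

Lemma env_ptE g h x y : env_pt g x = env_pt h y <->
  pa_dom theta ((h^-1 * g)%g, x) /\ pa_act theta (h^-1 * g)%g x = y.
Proof.
split=> [/env_classP/asboolP|[D E]]; rewrite /pa_set /= ?invMg ?invgK //.
by apply/env_classP/asboolP; rewrite /pa_set /= invMg invgK.
Qed.

Lemma env_ptV g h x y : env_pt h y = env_pt g x <->
  pa_dom theta ((h^-1 * g)%g, x) /\ pa_act theta (h^-1 * g)%g x = y.
Proof. by split=> [e|/env_ptE//]; apply/env_ptE. Qed.

Lemma env_pt_inj g : injective (env_pt g).
Proof. by move=> x y /env_ptE[_]; rewrite mulVg; have [_ ->] := pa_one theta x. Qed.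

Definition env_repr (z : Z) : discr_prod gT X := generic_quotient.repr z.

Lemma env_reprK z : env_pt (env_repr z).1 (env_repr z).2 = z.
Proof. by rewrite /env_pt -surjective_pairing /env_class reprK. Qed.

(** The partial inverse of [env_pt g], which serves as a chart on the piece [g]. *)
Definition env_coord (g : gT) (z : Z) : option X :=
  let p := env_repr z in
  if `[< pa_dom theta ((g^-1 * p.1)%g, p.2) >]
  then Some (pa_act theta (g^-1 * p.1)%g p.2) else None.

Lemma env_coordP g z x : env_coord g z = Some x <-> env_pt g x = z.
Proof.
rewrite /env_coord; have := env_reprK z; move: (env_repr z) => p /= <-.
case: asboolP => D; last by split=> // /env_ptV[].
by split=> [[<-]|/env_ptV[_ ->]//]; exact/env_ptV.
Qed.

Lemma env_coord_pt h g x : env_coord h (env_pt g x) =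
  if `[< dom (h^-1 * g)%g x >] then Some (pa_act theta (h^-1 * g)%g x) else None.
Proof.
case: asboolP => D; first exact/env_coordP/env_ptV.
by case E : env_coord => [y|//]; move/env_coordP/env_ptV: E => [].
Qed.

Lemma env_coord_some z : exists g x, env_coord g z = Some x.
Proof.
by exists (env_repr z).1, (env_repr z).2; apply/env_coordP; exact: env_reprK.
Qed.

Lemma env_act_pt g h x : env_act g (env_pt h x) = env_pt (g * h)%g x.
Proof. exact: env_actE. Qed.

Lemma env_act_laws : act_laws (env_act (theta := theta)).
Proof.
split=> [z|g h z]; rewrite -(env_reprK z) !env_act_pt ?mul1g ?mulgA //.
Qed.

Lemma env_coord_act h g z : env_coord (h * g)%g (env_act h z) = env_coord g z.
Proof.
case E : (env_coord g z) => [x|].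
  by move/env_coordP: E => <-; apply/env_coordP; rewrite env_act_pt.
case F : env_coord => [x|//]; move/env_coordP: F => F.
suff : env_coord g z = Some x by rewrite E.
apply/env_coordP; rewrite -(actKg env_act_laws h z) -F env_act_pt.
by rewrite mulKg.
Qed.

(** [X] with truncated metric and [None] added as an isolated point at distance 1. *)
Definition opt_dist (o p : option X) : R :=
  match o, p with
  | Some x, Some y => Num.min 1 (dX x y)
  | None, None => 0
  | _, _ => 1
  end.

Lemma opt_dist_le1 o p : opt_dist o p <= 1.
Proof. by case: o p => [x|] [y|] //=; rewrite ge_min lexx. Qed.

Lemma opt_dist_metric : is_metric opt_dist.
Proof.
have one0 : (1 : R) = 0 -> False by move/eqP; rewrite oner_eq0.
split.
- move=> [x|] [y|] /=; [|by split=> // /one0|by split=> // /one0|by []].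
  split=> [|[->]]; last by rewrite (metricxx dXm) /Num.min ltr10.
  rewrite /Num.min; case: ltP => _; first by move/one0.
  by move/(metric_eq0 dXm) => ->.
- by move=> [x|] [y|] //=; rewrite (metricC dXm).
- have m0 x y : 0 <= Num.min 1 (dX x y) by rewrite le_min ler01 (metric_ge0 dXm).
  have m1 x y : Num.min 1 (dX x y) <= 1 by rewrite ge_min lexx.
  move=> [x|] [y|] [z|] /=; rewrite ?addr0 ?add0r ?ler01 //.
  + have := metricD dXm x y z; have := metric_ge0 dXm x y; have := metric_ge0 dXm y z.
    by rewrite /Num.min; do 3 (case: ltP => ?); lra.
  + by rewrite lerDr.
  + by apply: le_trans (m1 x z) _; rewrite lerDl.
  + by rewrite lerDl.
Qed.

(** The largest distance between coordinates over all charts. A piece containing just one of the two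
    points counts 1, which makes the pieces clopen. *)
Definition env_dist (z w : Z) : R :=
  msup (fun g => opt_dist (env_coord g z) (env_coord g w)).

Lemma opt_dist_env g z w : opt_dist (env_coord g z) (env_coord g w) <= env_dist z w.
Proof.
apply: (@msup_ub _ _ (fun g => opt_dist (env_coord g z) (env_coord g w))) => h.
exact: opt_dist_le1.
Qed.

Lemma env_dist_le1 z w : env_dist z w <= 1.
Proof. by apply: msup_le => // g; exact: opt_dist_le1. Qed.

Lemma env_dist_metric : is_metric env_dist.
Proof.
have om := opt_dist_metric; split.
- move=> z w; split=> [zw|->]; last first.
    apply/eqP; rewrite eq_le; apply/andP; split; last first.
      by apply: msup_ge0 => g; exact: opt_dist_le1.
    by apply: msup_le => // g; rewrite (metricxx om).
  have [g [x gz]] := env_coord_some z.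
  have : env_coord g z = env_coord g w.
    apply/(metric_eq0 om)/eqP; rewrite eq_le (metric_ge0 om) andbT -zw.
    exact: opt_dist_env.
  by rewrite gz => /esym/env_coordP <-; move/env_coordP: gz.
- by move=> z w; congr msup; apply/funext => g; rewrite (metricC om).
- move=> x y z; apply: msup_le => [|g].
    by rewrite addr_ge0 // msup_ge0 // => g; exact: opt_dist_le1.
  apply: le_trans (metricD om _ (env_coord g y) _) _.
  by rewrite lerD // opt_dist_env.
Qed.

Lemma env_act_isometric : isometric env_dist (env_act (theta := theta)).
Proof.
move=> h z w; apply: (@msup_reindex _ _ (fun g => h * g)%g (fun g => h^-1 * g)%g) => g.
  by rewrite mulKVg.
by rewrite !env_coord_act.
Qed.

Lemma env_pt_open g x w e : e <= 1 -> env_dist (env_pt g x) w < e ->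
  exists2 y, dX x y < e & env_pt g y = w.
Proof.
move=> e1 /(le_lt_trans (opt_dist_env g _ _)).
have -> : env_coord g (env_pt g x) = Some x by apply/env_coordP.
case E : env_coord => [y|] /=; last by rewrite ltNge e1.
rewrite gt_min ltNge e1 /= => xy; exists y => //; exact/env_coordP.
Qed.

(** The domain of each group element is clopen: open since the partial action is topological, closed
    since [G*X] is closed. *)
Lemma dom_near k x : mnear dX x (fun y => dom k y <-> dom k x).
Proof.
have [Dx|nDx] := pselect (dom k x).
  have [ok _] := theta_top k^-1%g.
  have := (mopen_open _ dXc).1 ok x; rewrite /pa_set /= invgK => /(_ Dx).
  by apply: mnearW => y Dy; split.
have oc : open (~` (pa_graph theta)) by rewrite openC.
have /(mopen_open _ dXc) h := (open_discr_prod _).1 oc k.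
by apply: mnearW (h x nDx) => y nDy; split.
Qed.

Lemma dom_act_cont k : cont_on dX dX (dom k) (pa_act theta k).
Proof.
have [_ [f' [_ _ kc _]]] := theta_top k.
by move/(within_contP _ _ dXc dXc): kc; rewrite /pa_set invgK.
Qed.

(** In the chart [h] the point [env_pt g y] has coordinate the action of [h^-1 g] on [y], continuous
    on a domain that is locally constant by [dom_near]. *)
Lemma env_pt_cont g x e : 0 < e ->
  mnear dX x (fun y => env_dist (env_pt g x) (env_pt g y) < e).
Proof.
move=> e0.
suff : mnear dX x (fun y => forall h,
    opt_dist (env_coord h (env_pt g x)) (env_coord h (env_pt g y)) <= e / 2).
  apply: mnearW => y h; apply: (@le_lt_trans _ _ (e / 2)); last lra.
  by apply: msup_le => //; lra.
apply: mnear_fin => h; rewrite env_coord_pt; pose k := (h^-1 * g)%g.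
have [Dx|nDx] := asboolP (dom k x); last first.
  apply: mnearW (dom_near k x) => y yx; rewrite env_coord_pt.
  by case: asboolP => [/yx//|_] /=; lra.
have e20 : 0 < e / 2 by lra.
apply: mnearW (mnearI (dom_near k x) (dom_act_cont Dx e20)) => y [/iffRL/(_ Dx) Dy].
move=> /(_ Dy) xy; rewrite env_coord_pt; case: asboolP => //= _.
by rewrite ge_min (ltW xy) orbT.
Qed.

Lemma env_pt_mnear g x P : mnear env_dist (env_pt g x) P ->
  mnear dX x (fun y => P (env_pt g y)).
Proof.
by move=> [e e0 eP]; apply: mnearW (env_pt_cont g x e0) => y; exact: eP.
Qed.

(** A set is open in the quotient when its preimages under all [env_pt g] are open; these maps are
    continuous and open for [env_dist]. *)
Lemma env_compatible : compatible env_dist.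
Proof.
split; first exact: env_dist_metric.
have openP (U : set Z) : open U <-> mopen env_dist U.
  have -> : open U <-> forall g, open [set x | U (env_pt g x)].
    exact: (open_discr_prod (\pi_(quotient_topology {eq_quot env_equiv theta})%qT @^-1` U)).
  split=> [h z|h g].
    rewrite -{1}(env_reprK z) => Uz.
    have [e e0 eU] := (mopen_open _ dXc).1 (h (env_repr z).1) _ Uz.
    exists (Num.min e 1); first by rewrite lt_min e0 ltr01.
    move=> w; rewrite -{1}(env_reprK z) => /env_pt_open[|y].
      by rewrite ge_min lexx orbT.
    by rewrite lt_min => /andP[/eU + _] <-.
  by apply/(mopen_open _ dXc) => x Ux; apply: env_pt_mnear; exact: h.
move=> z A; split=> [|[e e0 eA]].
  by rewrite nbhsE => -[B [/openP oB Bz] BA]; apply: mnearW BA (oB _ Bz).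
rewrite nbhsE; exists [set w | mnear env_dist w A]; last first.
  by move=> w /(mnear_self env_dist_metric).
split; last by exists e.
by apply/openP => w wA; exact: (mnear_mnear env_dist_metric wA).
Qed.

End Envelope.

(** * Extension property of the fixed point sets of the enveloping space *)

Section EnvelopeFixedPoints.
Variables (R : realType) (gT : finGroupType) (X : topologicalType).
Variables (theta : partial_action gT X) (dX : X -> X -> R).
Hypothesis dXc : compatible dX.
Hypotheses (theta_top : topological_pa theta) (theta_cl : closed (pa_graph theta)).

Local Notation Z := (env_space theta).
Local Notation dZ := (env_dist (theta := theta) dX).
Local Notation aZ := (env_act (theta := theta)).

(** The choice depends only on the set of pieces containing [z], hence is locally constant. *)
Definition env_piece (z : Z) : gT := odflt 1%g [pick g | isSome (env_coord g z)].

Lemma env_pieceP z : exists x, env_pt theta (env_piece z) x = z.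
Proof.
rewrite /env_piece; case: pickP => [g|] /=.
  by case E : env_coord => [x|//] _; exists x; apply/env_coordP.
by have [g [x gx]] := env_coord_some z; move=> /(_ g); rewrite gx.
Qed.

Lemma env_piece_near z w : dZ z w < 1 -> env_piece z = env_piece w.
Proof.
move=> zw; rewrite /env_piece; congr odflt; apply: eq_pick => g.
have := le_lt_trans (opt_dist_env dX g z w) zw.
by case: env_coord => [x|]; case: env_coord => [y|] //=; rewrite ltxx.
Qed.

(** [h] fixes [[g, x]] exactly when its conjugate [g^-1 h g] fixes [x]. *)
Lemma env_pt_fix (H : {group gT}) g x :
  fixset aZ H (env_pt theta g x) <-> pa_fix theta (H :^ g)%G x.
Proof.
split=> hx h hH.
  have hH' : (h ^ g^-1)%g \in H by rewrite -mem_conjg.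
  have := hx _ hH'; rewrite env_act_pt => /env_ptE.
  by rewrite /conjg invgK !mulgA mulVg mul1g mulgKV.
have hH' : (h ^ g)%g \in (H :^ g)%G by rewrite memJ_conjg.
have [] := hx _ hH'; rewrite env_act_pt => D E; apply/env_ptE.
by move: D E; rewrite /conjg !mulgA.
Qed.

(** [C] splits into relatively clopen parts [Cg g] according to [env_piece]. On each, the coordinate
    of [f] is a map into the ANE [X[H^g]]; the extensions are glued over disjoint open sets. *)
Lemma fixset_ext_property (H : {group gT}) :
  (forall K : {group gT}, ANE R (pa_fix theta K)) -> ext_property dZ (fixset aZ H).
Proof.
move=> fANE Y dY dYm B C CB Ccl f fc fH.
pose x y : X := xget (env_repr (f y)).2 [set x | env_pt theta (env_piece (f y)) x = f y].
have xP y : env_pt theta (env_piece (f y)) (x y) = f y.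
  by rewrite /x; case: xgetP => // nE; have [x0 /nE] := env_pieceP (f y).
pose Cg g := [set y | C y /\ env_piece (f y) = g].
have near y : C y -> mnear dY y (fun z => C z -> env_piece (f z) = env_piece (f y)).
  move=> Cy; apply: mnearW (fc y Cy 1 ltr01) => z h Cz.
  by apply/esym/env_piece_near; exact: h.
have ex g : exists p : set Y * (Y -> X),
    [/\ p.1 `<=` B, Cg g `<=` p.1, nbhd_in dY B (Cg g) p.1, cont_on dY dX p.1 p.2 &
        (forall y, p.1 y -> pa_fix theta (H :^ g)%G (p.2 y)) /\
        (forall y, Cg g y -> p.2 y = x y)].
  have [] := ANE_ext_property dXc (fANE (H :^ g)%G) dYm (_ : Cg g `<=` B) _ (_ : cont_on _ _ _ x);
    last by move=> U [F UF]; exists (U, F).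
  - by move=> y [/CB].
  - move=> y By nCy; have [Cy|nC] := pselect (C y).
      apply: mnearW (near y Cy) => z h [Cz zg]; apply: nCy; split => //.
      by rewrite -h.
    by apply: mnearW (Ccl y By nC) => z nz [].
  - move=> y [Cy yg] e e0.
    have e'0 : 0 < Num.min e 1 by rewrite lt_min e0 ltr01.
    apply: mnearW (fc y Cy _ e'0) => z h [Cz zg]; have := h Cz.
    rewrite -(xP y) -(xP z) yg zg => /env_pt_open[|x' + /env_pt_inj <-].
      by rewrite ge_min lexx orbT.
    by rewrite lt_min => /andP[].
  - by move=> y [Cy yg]; apply/env_pt_fix; rewrite -yg xP; exact: fH.
have {ex} [p pP] := choice ex.
(* Points nearer to [Cg g] than to the rest of [C]: disjoint open sets separating the parts. *)
pose closer g := [set y | dist1 dY (Cg g) y < dist1 dY (C `\` Cg g) y].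
have closer_near g y : closer g y -> mnear dY y (closer g).
  rewrite /closer /= => yg.
  exists ((dist1 dY (C `\` Cg g) y - dist1 dY (Cg g) y) / 2); first by rewrite divr_gt0 // subr_gt0.
  move=> z yz; have := dist1_tri dYm (Cg g) z y.
  have := dist1_tri dYm (C `\` Cg g) y z; rewrite (metricC dYm z y) => h1 h2 /=; lra.
have closer_uniq g h y : closer g y -> closer h y -> g = h.
  move=> yg yh; apply: contrapT => gh.
  have sub k l : k <> l -> Cg k `<=` C `\` Cg l.
    by move=> kl z [Cz zk]; split => // -[_ zl]; apply: kl; rewrite -zk zl.
  have := dist1_sub dYm y (sub _ _ gh).
  have := dist1_sub dYm y (sub _ _ (not_eq_sym gh)).
  by move: yg yh; rewrite /closer /=; lra.
have C_closer y : C y -> closer (env_piece (f y)) y.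
  move=> Cy; rewrite /closer /= dist1_mem //; apply: dist1_gt0 => //.
  by apply: mnearW (near y Cy) => z h [Cz]; apply; split => //; exact: h.
pose gam y := xget 1%g [set g | closer g y].
have gamE g y : closer g y -> gam y = g.
  by move=> yg; rewrite /gam; case: xgetP => [h _ /closer_uniq|/(_ g)//]; exact.
exists [set y | exists2 g, (p g).1 y & closer g y],
  (fun y => env_pt theta (gam y) ((p (gam y)).2 y)); split.
- by move=> y [g py _]; have [pB _ _ _ _] := pP g; exact: pB.
- move=> y Cy; exists (env_piece (f y)); last exact: C_closer.
  by have [_ Cp _ _ _] := pP (env_piece (f y)); exact: Cp.
- move=> y Cy; have [_ _ pn _ _] := pP (env_piece (f y)).
  apply: mnearW (mnearI (pn y (conj Cy erefl)) (closer_near _ _ (C_closer y Cy))).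
  by move=> z [h1 h2] /h1 h3; exists (env_piece (f y)).
- move=> y [g py yg] e e0; rewrite (gamE g) //.
  have [_ _ _ pc _] := pP g.
  have [d d0 dP] := env_pt_cont dXc theta_top theta_cl g ((p g).2 y) e0.
  apply: mnearW (mnearI (closer_near _ _ yg) (pc y py d d0)) => z [zg hz] [g' pz zg'].
  have gg' := closer_uniq _ _ _ zg zg'; rewrite -gg' in pz.
  by rewrite (gamE g) //; apply: dP; exact: hz.
- split=> y.
    move=> [g py yg]; rewrite (gamE g) //; apply/env_pt_fix.
    by have [_ _ _ _ [pf _]] := pP g; exact: pf.
  move=> Cy; rewrite (gamE _ _ (C_closer y Cy)).
  have [_ _ _ _ [_ pE]] := pP (env_piece (f y)).
  by rewrite pE // xP.
Qed.

End EnvelopeFixedPoints.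

(** * Separability and covering dimension in metric terms *)

Section Refinement.
Variables (R : realType) (X : topologicalType) (dX : X -> X -> R).
Hypothesis dXc : compatible dX.

Lemma separable_dense_seq (x0 : X) : separable X ->
  exists s : nat -> X, forall x e, 0 < e -> exists n, dX x (s n) < e.
Proof.
move=> [S /countable_injP[c cI] Sd].
exists (fun n => xget x0 [set x | S x /\ c x = n]) => x e e0.
pose U := [set y | mnear dX y (fun z => dX x z < e)].
have Ux : U x by exists e.
have [||y [Uy Sy]] := Sd U.
- by exists x.
- by apply/(mopen_open _ dXc) => y Uy; exact: (mnear_mnear dXc.1 Uy).
exists (c y); case: xgetP => [z _ [Sz cz]|/(_ y)]; last by move=> h; exfalso; exact: h.
have -> : z = y by apply: cI; rewrite ?inE.
exact: (mnear_self dXc.1 Uy).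
Qed.

Lemma covering_dim_le_mopen n : covering_dim_le X n -> finite_cover_dim dX n.
Proof.
move=> Xn k U Uo Uc.
have [|m [V [Vo Vc VU VJ]]] := Xn k U _ Uc.
  by move=> i; apply/(mopen_open _ dXc).
by exists m, V; split=> // j; apply/(mopen_open _ dXc).
Qed.

End Refinement.

Theorem theorem4p17 (R : realType) (gT : finGroupType) (X : topologicalType)
    (theta : partial_action gT X)
    (X_metrizable : metrizable R X)
    (X_separable : separable X)
    (X_findim : finite_dimensional X)
    (theta_Gspace : G_space theta)
    (theta_nice : nice theta)
    (theta_closed : closed (pa_graph theta))
    (fix_ANE : forall H : {group gT}, ANE R (pa_fix theta H)) :
  G_ANE R (env_act (theta := theta)).
Proof.
have [dX dXc] := (metrizableP R X).1 X_metrizable.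
have [top _] := theta_Gspace.
have dZc := env_compatible dXc top theta_closed.
have dZm := dZc.1.
have aZA := env_act_laws theta.
have aZi : isometric (env_dist (theta := theta) dX) (env_act (theta := theta)).
  exact: env_act_isometric.
split.
- by apply/metrizableP; exists (env_dist (theta := theta) dX).
- have [a1 aM] := aZA; split => // -[g z] P /dZc.2 nP.
  by apply/nbhs_discr_prod/dZc.2; apply: mnear_act aZi nP.
move=> Y aY mY cY A Acl Ainv f fc fe.
have [dY [dYc aYA aYi]] := invariant_metric mY cY.
(* A point of [Y] provides, through [f], the base points of [Z] and [X] used as defaults. *)
have [[y0 _]|nY] := pselect (exists y : Y, True); last first.
  exists set0, f; split.
  - by move=> y; exfalso; apply: nY; exists y.
  - by move=> g y.
  - exact: continuous_subspace0.
  - by move=> g y.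
  - by [].
have [s sd] := separable_dense_seq dXc (env_repr (f y0)).2 X_separable.
have [n /(covering_dim_le_mopen dXc) dn] := X_findim.
have rX := refinable_separable dXc.1 sd dn.
have rZ : refinable (env_dist (theta := theta) dX) (#|gT| * (n.+1 + n.+1))%N.
  apply: (refinable_pieces (q := env_pt theta) _ _ _ _ rX).
  - by move=> z; exists (env_repr z).1, (env_repr z).2; exact: env_reprK.
  - exact: env_pt_inj.
  - move=> g x P [e e0 eP]; exists (Num.min e 1); first by rewrite lt_min e0 ltr01.
    move=> w /env_pt_open[|y + yw]; first by rewrite ge_min lexx orbT.
    by rewrite lt_min => /andP[/eP Py _]; exists y.
  - exact: env_pt_mnear.
have e0 k : 0 < (2^-1 : R) ^+ k by rewrite exprn_gt0 // invr_gt0.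
(* One cover for each mesh [2^-k], all with the same order bound, so that the number of retraction
   steps is fixed in advance. *)
have [Oc gO] := choice (fun k => good_cover_exists dZm aZA aZi (f y0) rZ (e0 k)).
have [U [F [AU Ui Fc Fe FE]]] := equivariant_extension dZm aZA aZi (env_dist_le1 (theta := theta) dX) gO
  dYc.1 aYA aYi (closed_closed_in dYc Acl) Ainv ((within_contP _ _ dYc dZc).1 fc) fe
  (fun H => fixset_ext_property dXc top theta_closed (H := H) fix_ANE) (f y0).
exists U, F; split => //.
- move=> a Aa; apply/dYc.2; apply: mnearW (AU a Aa) => y; exact.
- exact/(within_contP _ _ dYc dZc).
- by move=> a; rewrite inE; exact: FE.
Qed.
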